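(* Let $\mathbb{H}^n$ ($n\ge2$) be the $n$-dimensional hyperbolic space. Let $b,c\in\mathbb{R}$, $0<p_3<\infty$ and $1<p_2<\infty$. Let $\delta\in(0,1]\cap\left(\frac{p_3-p_2}{p_3},1\right]$. Assume $$0\le b(1-\delta)-c<n\left(\frac1{p_3}-\frac{1-\delta}{p_2}\right)\quad\text{and}\quad n\le q:=\frac{\delta p_2p_3}{p_2-(1-\delta)p_3},$$ and put $\beta:=\frac{q\,(b(1-\delta)-c)}{\delta}\in[0,n)$. There exists a constant $C_2=C_2(n,\beta,q)>0$ such that $$\left\|\frac{f}{\rho^{\beta/q}}\right\|_{L^q(\mathbb{H}^n)}\le C_2\,q^{1-1/n}\,\|\nabla_g f\|_{L^n(\mathbb{H}^n)}\quad\text{for all } f\in W^{1,n}_0(\mathbb{H}^n),$$ and for any such constant $C_2$ one has $$\|\rho^c f\|_{L^{p_3}(\mathbb{H}^n)}\le\widehat{C_3}\,\|\nabla_g f\|^{\delta}_{L^n(\mathbb{H}^n)}\,\|\rho^b f\|^{1-\delta}_{L^{p_2}(\mathbb{H}^n)}$$ for all $f\in W^{1,n}_0(\mathbb{H}^n)$, where $$\widehat{C_3}=C_2^{\delta}\left(\frac{\delta p_2p_3}{p_2-(1-\delta)p_3}\right)^{\delta-\frac{\delta}{n}}.$$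
   Context: $\mathbb{H}^n$ is the Poincaré ball model: the unit ball of $\mathbb{R}^n$ with metric $ds^2=4\sum_i dx_i^2/(1-|x|^2)^2$, volume form $dV_g=2^n(1-|x|^2)^{-n}dx$, and $\rho(x)=\ln\frac{1+|x|}{1-|x|}$ the hyperbolic distance to the origin. $\nabla_g$ is the Riemannian gradient, $|\nabla_g f|$ its Riemannian length, and $\|f\|_{L^p(\mathbb{H}^n)}=(\int_{\mathbb{H}^n}|f|^p\,dV_g)^{1/p}$ for $0<p<\infty$ (possibly $+\infty$). $W^{1,n}_0(\mathbb{H}^n)$ is the completion of $C_0^\infty(\mathbb{H}^n)$ in the norm $\left(\int_{\mathbb{H}^n}(|\nabla_g f|^n+|f|^n)\,dV_g\right)^{1/n}$. When $\delta=1$ the factor with exponent $1-\delta=0$ is read as $1$. *)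

(* Defs.v *)
From HB Require Import structures.
From mathcomp Require Import all_boot all_order all_algebra.
From mathcomp Require Import all_classical all_reals all_analysis.
From mathcomp Require Import measurable_realfun.

Set Implicit Arguments.
Unset Strict Implicit.
Unset Printing Implicit Defensive.

Import Order.TTheory GRing.Theory Num.Theory.
Import numFieldNormedType.Exports.

Local Open Scope classical_set_scope.
Local Open Scope ring_scope.

(* 'rV[R]_n carries the sigma-algebra generated by the coordinate maps, i.e. *)
(* the Borel sets of R^n.                                                    *)
Definition rV_display : measure_display -> measure_display.
Proof. exact. Qed.

Section measurable_rV.
Context {R : realType} (n : nat).

Let coord (i : 'I_n) (x : 'rV[R]_n) : R := x ord0 i.

Let rV_set0 : g_sigma_preimage coord set0.
Proof. exact: sigma_algebra0. Qed.

Let rV_setC A : g_sigma_preimage coord A -> g_sigma_preimage coord (~` A).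
Proof. exact: sigma_algebraC. Qed.

Let rV_bigcup (F : (set 'rV[R]_n)^nat) :
  (forall i, g_sigma_preimage coord (F i)) ->
  g_sigma_preimage coord (\bigcup_i (F i)).
Proof. exact: sigma_algebra_bigcup. Qed.

HB.instance Definition _ := @isMeasurable.Build
  (rV_display default_measure_display) 'rV[R]_n
  (g_sigma_preimage coord) rV_set0 rV_setC rV_bigcup.

Lemma measurable_coord (i : 'I_n) :
  measurable_fun [set: 'rV[R]_n] (fun x : 'rV[R]_n => x ord0 i).
Proof.
move=> _ Y mY; rewrite setTI; apply: sub_sigma_algebra => /=.
rewrite -bigcup_seq/=; exists i => /=; first by rewrite mem_index_enum.
by exists Y => //; rewrite setTI.
Qed.

Lemma measurable_rV d (T : measurableType d) (f : T -> 'rV[R]_n) :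
  (forall i, measurable_fun [set: T] (fun x => f x ord0 i)) ->
  measurable_fun [set: T] f.
Proof.
move=> mf; suff : g_sigma_preimage (fun i => coord i \o f) `<=` measurable.
  rewrite g_sigma_preimage_comp => h _ A mA; apply: h; exists A => //.
apply: smallest_sub; first exact: sigma_algebra_measurable.
by rewrite -bigcup_seq/=; apply: bigcup_sub => i _ A [B mB <-]; exact: mf.
Qed.

End measurable_rV.

(* Lebesgue measure on R^n, by R^(n+1) = R * R^n. *)
Section lebesgue_rV.
Context {R : realType}.

Definition cons_rV n (p : measurableTypeR R * 'rV[R]_n) : 'rV[R]_n.+1 :=
  \row_i oapp (p.2 ord0) p.1 (unlift ord0 i).

Lemma measurable_cons_rV n : measurable_fun [set: _] (@cons_rV n).
Proof.
apply: measurable_rV => i; case: (unliftP ord0 i) => [j|] ->.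
  under eq_fun do rewrite mxE liftK/=.
  by apply: (measurableT_comp (measurable_coord j)); exact: measurable_snd.
by under eq_fun do rewrite mxE unlift_none/=; exact: measurable_fst.
Qed.

Definition uncons_rV n (x : 'rV[R]_n.+1) : measurableTypeR R * 'rV[R]_n :=
  (x ord0 ord0, \row_j x ord0 (lift ord0 j)).

Lemma measurable_uncons_rV n : measurable_fun [set: _] (@uncons_rV n).
Proof.
apply/measurable_fun_pairP; split; first exact: measurable_coord.
apply: measurable_rV => i; rewrite /comp/=.
by under eq_fun do rewrite mxE; exact: measurable_coord.
Qed.

Lemma cons_rVK n : cancel (@cons_rV n) (@uncons_rV n).
Proof.
move=> [t x]; congr (_, _); first by rewrite mxE unlift_none.
by apply/rowP => j; rewrite !mxE liftK.
Qed.

Section step.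
Context n (m : {sigma_finite_measure set 'rV[R]_n -> \bar R}).

Definition lebesgue_step : set 'rV[R]_n.+1 -> \bar R :=
  pushforward (lebesgue_measure \x m)%E (@cons_rV n).

Let step0 : lebesgue_step set0 = 0%E.
Proof. by rewrite /lebesgue_step /pushforward preimage_set0 measure0. Qed.

Let step_ge0 A : (0 <= lebesgue_step A)%E.
Proof. exact: (measure_ge0 (lebesgue_measure \x m)%E). Qed.

Let step_sigma_additive : semi_sigma_additive lebesgue_step.
Proof.
move=> F mF tF mUF; rewrite /lebesgue_step/pushforward preimage_bigcup.
have mc A : measurable A -> measurable (@cons_rV n @^-1` A).
  by move=> mA; rewrite -[_ @^-1` _]setTI; exact: measurable_cons_rV.
apply: measure_semi_sigma_additive.
- by move=> k; exact: mc.
- apply/trivIsetP => /= i j _ _ ij; rewrite -preimage_setI.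
  by move/trivIsetP : tF => /(_ _ _ _ _ ij) ->//; rewrite preimage_set0.
- by rewrite -preimage_bigcup; exact: mc.
Qed.

HB.instance Definition _ := isMeasure.Build _ _ _
  lebesgue_step step0 step_ge0 step_sigma_additive.

Let step_sigma_finite : sigma_finite setT lebesgue_step.
Proof.
have /sigma_finiteP[F [TF ndF Foo]] := sigma_finiteT (@lebesgue_measure R).
have /sigma_finiteP[G [TG ndG Goo]] := sigma_finiteT m.
exists (fun k => @uncons_rV n @^-1` (F k `*` G k)).
  rewrite -preimage_bigcup (_ : \bigcup_k (F k `*` G k) = setT)//.
  apply/seteqP; split=> // -[t x] _.
  have [k _ Fk] : (\bigcup_k F k) t by rewrite -TF.
  have [l _ Gl] : (\bigcup_k G k) x by rewrite -TG.
  exists (maxn k l) => //; split => /=.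
  - by move: t Fk; exact/subsetPset/ndF/leq_maxl.
  - by move: x Gl; exact/subsetPset/ndG/leq_maxr.
move=> k; have [mFk Fk] := Foo k; have [mGk Gk] := Goo k; split.
  rewrite -[_ @^-1` _]setTI; apply: measurable_uncons_rV => //.
  exact: measurableX.
rewrite /lebesgue_step /pushforward -comp_preimage.
rewrite (_ : @uncons_rV n \o @cons_rV n = id); last exact/funext/cons_rVK.
by rewrite preimage_id product_measure1E// lte_mul_pinfty// ge0_fin_numE.
Qed.

HB.instance Definition _ := @Measure_isSigmaFinite.Build _ _ _
  lebesgue_step step_sigma_finite.

End step.

Fixpoint lebesgue_rV n : {sigma_finite_measure set 'rV[R]_n -> \bar R} :=
  if n is k.+1 then lebesgue_step (lebesgue_rV k)
  else \d_(0 : 'rV[R]_0).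

End lebesgue_rV.


Section hyperbolic_space.
Context {R : realType} {n : nat}.
Implicit Types (x u v : 'rV[R]_n) (f : 'rV[R]_n -> R).

(* Euclidean norm; the library norm `|x| on 'rV[R]_n is the sup norm. *)
Definition enorm x : R := Num.sqrt (\sum_i x ord0 i ^+ 2).

Definition hball : set 'rV[R]_n := [set x | enorm x < 1].

(* g_x(u, v) for the Poincare metric g = 4 |dx|^2 / (1 - |x|^2)^2. *)
Definition hmetric x u v : R :=
  4 * (\sum_i u ord0 i * v ord0 i) / (1 - enorm x ^+ 2) ^+ 2.

Definition hlen x v : R := Num.sqrt (hmetric x v v).

Definition hrho x : R := ln ((1 + enorm x) / (1 - enorm x)).

Definition hdensity x : R := 2 ^+ n / (1 - enorm x ^+ 2) ^+ n.

Lemma hdensity_ge0 x : hball x -> 0 <= hdensity x.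
Proof.
move=> x1; rewrite /hdensity divr_ge0 ?exprn_ge0// subr_ge0.
by rewrite expr_le1 ?sqrtr_ge0// ltW.
Qed.

Lemma measurable_enorm : measurable_fun [set: 'rV[R]_n] enorm.
Proof.
apply: (@measurableT_comp _ _ _ _ _ _ (@Num.sqrt R)).
  by apply: continuous_measurable_fun; exact: sqrt_continuous.
apply: measurable_sum => i; apply: measurable_funX; exact: measurable_coord.
Qed.

Lemma measurable_hball : measurable hball.
Proof.
rewrite (_ : hball = enorm @^-1` `]-oo, 1[); last first.
  by apply/seteqP; split => x; rewrite /= in_itv.
by rewrite -[_ @^-1` _]setTI; exact: measurable_enorm.
Qed.

Lemma measurable_hdensity : measurable_fun hball hdensity.
Proof.
apply: (@eq_measurable_fun _ _ _ _ hball
  (fun x => 2 ^+ n * ((1 - enorm x ^+ 2) ^+ n) `^ (- 1))).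
  move=> x /set_mem x1; rewrite powR_inv1// exprn_ge0// subr_ge0.
  by rewrite expr_le1 ?sqrtr_ge0// ltW.
apply: measurable_funTS; apply: measurable_funM => //.
apply: (@measurableT_comp _ _ _ _ _ _ (fun y : R => y `^ (- 1))).
  exact: measurable_powR.
apply: measurable_funX; apply: measurable_funB => //.
by apply: measurable_funX; exact: measurable_enorm.
Qed.

(* The hyperbolic volume dV_g, as a measure on R^n concentrated on the ball: *)
(* functions on H^n are functions on R^n whose values off the ball are       *)
(* irrelevant.                                                               *)
Definition hvol (A : set 'rV[R]_n) : \bar R :=
  (\int[lebesgue_rV n]_(x in A `&` hball) (hdensity x)%:E)%E.

Let hvol0 : hvol set0 = 0%E.
Proof. by rewrite /hvol set0I integral_set0. Qed.

Let hvol_ge0 A : (0 <= hvol A)%E.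
Proof.
by apply: integral_ge0 => x [_ x1]; rewrite lee_fin hdensity_ge0.
Qed.

Let hvol_sigma_additive : semi_sigma_additive hvol.
Proof.
move=> /= F mF tF mUF; rewrite /hvol; apply: cvg_toP.
  apply: ereal_nondecreasing_is_cvgn => a b ab.
  apply: lee_sum_nneg_natr => // k _ _; apply: integral_ge0 => /= x [_ x1].
  by rewrite lee_fin hdensity_ge0.
rewrite setI_bigcupl ge0_integral_bigcup//=.
- by move=> k; apply: measurableI => //; exact: measurable_hball.
- apply/measurable_EFinP; apply: (measurable_funS measurable_hball).
    by move=> x [k _ []].
  exact: measurable_hdensity.
- by move=> x [k _ [_ x1]]; rewrite lee_fin hdensity_ge0.
- exact: trivIset_setIr.
Qed.

HB.instance Definition _ := isMeasure.Build _ _ _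
  hvol hvol0 hvol_ge0 hvol_sigma_additive.

Definition partial (i : 'I_n) f : 'rV[R]_n -> R :=
  fun x => 'D_(delta_mx ord0 i) f x.

(* The Riemannian gradient: hmetric x (hgrad f x) v is the differential of f *)
(* at x applied to v.                                                        *)
Definition hgrad f x : 'rV[R]_n :=
  ((1 - enorm x ^+ 2) ^+ 2 / 4) *: \row_i partial i f x.

(* Smoothness: the iterated partial derivatives of all orders exist and are *)
(* continuous.                                                              *)
Definition smooth f : Prop := forall s : seq 'I_n,
  continuous (foldr partial f s) /\
  forall i x, derivable (foldr partial f s) x (delta_mx ord0 i).

Definition test_function f : Prop :=
  let supp := closure [set x | f x != 0] in
  [/\ smooth f, compact supp & supp `<=` hball].

End hyperbolic_space.

Arguments hball {R n}.
Arguments hvol {R n}.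

(* W^{1,n}_0(H^n): the completion of the test functions, realised as the    *)
(* closure of the graph { (phi, grad_g phi) } in L^n(dV_g) x L^n(dV_g; TH^n) *)
(* (functions and fields are representatives of their almost-everywhere      *)
(* classes). sob_grad is the extension of the Riemannian gradient to it.     *)
Record sobolev (R : realType) (n : nat) := Sobolev {
  sob_fun :> 'rV[R]_n -> R;
  sob_grad : 'rV[R]_n -> 'rV[R]_n;
  sob_fun_measurable : measurable_fun [set: 'rV[R]_n] sob_fun;
  sob_grad_measurable : measurable_fun [set: 'rV[R]_n] sob_grad;
  sob_approx : exists phi : nat -> 'rV[R]_n -> R,
    (forall k, test_function (phi k)) /\
    (fun k => \int[hvol]_x
       (hlen x (hgrad (phi k) x - sob_grad x) ^+ n
        + `|phi k x - sob_fun x| ^+ n)%:E)%E @ \oo --> 0%E }.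

Definition hLnorm (R : realType) (n : nat) (p : R) (f : 'rV[R]_n -> R) :
  \bar R := 'N[hvol]_(p%:E)[EFin \o f]%E.

Definition grad_norm (R : realType) (n : nat) (f : sobolev R n) : \bar R :=
  hLnorm n%:R (fun x => hlen x (sob_grad f x)).

(* The singular Sobolev inequality with constant C; f / rho^(beta/q) is only *)
(* meaningful off the origin, which is a null set.                           *)
Definition singular_sobolev (R : realType) (n : nat) (beta q C : R) : Prop :=
  forall f : sobolev R n,
    (hLnorm q (fun x => (f x / hrho x `^ (beta / q))%R)
     <= (C * q `^ (1 - n%:R^-1))%:E * grad_norm f)%E.

(* Main.v *)
(* By conformal invariance the n-energy of f is the Euclidean integral of
   |grad f|^n over the ball. Write t = 1 - |x|^2, so that dV_g = 2^n t^-n dx, and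
   let A_s be the integral of |f|^s t^-n. Integrating the divergence of
   |f|^n t^-(n-1) x, whose second factor has divergence at least n t^-n, gives
   the Hardy inequality A_n <= C |grad f|^n. The Gagliardo-Nirenberg inequality
   applied to f^a t^-(n-1) bounds A_(a n/(n-1)) by A_((a-1) n/(n-1)), A_a and the
   energy; iterating over a = n, n+1, ... bounds A_s for every s >= n. The
   singularity of rho^-beta at the origin is then absorbed by Young's inequality,
   as |x|^-r is integrable there for r < n. This is the singular Sobolev
   inequality for test functions; it passes to the completion by scaling and
   Fatou's lemma along a rapidly convergent subsequence. The interpolation
   inequality is Hoelder's inequality for
   rho^c f = (rho^(-beta/q) f)^delta (rho^b f)^(1-delta). *)

Require Import Defs.
From mathcomp Require Import all_boot all_order all_algebra.
From mathcomp Require Import all_classical all_reals all_analysis.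
From mathcomp Require Import measurable_realfun ring lra.

Import Order.TTheory GRing.Theory Num.Theory.
Import numFieldNormedType.Exports.

Local Open Scope classical_set_scope.
Local Open Scope ring_scope.

Set Implicit Arguments.
Unset Strict Implicit.
Unset Printing Implicit Defensive.

(** * Iterated integrals on R^n *)

Section tonelli_rV.
Context {R : realType}.
Local Notation mu := (@lebesgue_measure R).
Local Notation L := lebesgue_rV.

(** The weight t^-(n-1) in the iteration is forced. The power n/(n-1) coming from
    Gagliardo-Nirenberg turns it into the volume weight t^-n, and its derivative is again of order
    t^-n inside the ball, so every step stays within the family A_s. Each step splits off the
    gradient by Young's inequality and is therefore not homogeneous in [f]; the bounds are proved
    for energy at most 1 and scaled afterwards. Crude constants are enough, because C_2 may depend
    on beta and q in any way: the factor q^(1-1/n) is divided out at the end, and no rate of growth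
    in q has to be established. Odd powers of [|f|] are not smooth, so the argument runs in the
    class of functions with continuous partial derivatives and support in a compact subset of the
    ball; it is stable under composition with C^1 functions vanishing at 0 and under multiplication
    by factors that are regular only inside the ball. *)

Definition upd n (i : 'I_n) (x : 'rV[R]_n) (s : R) : 'rV[R]_n :=
  \row_j if j == i then s else x ord0 j.

Lemma upd_cons0 n (t s : R) (y : 'rV[R]_n) :
  upd ord0 (cons_rV (t, y)) s = cons_rV (s, y).
Proof.
apply/rowP => j; rewrite !mxE; case: (unliftP ord0 j) => [k|] ->.
  by rewrite eq_sym (negbTE (neq_lift _ _)) /= ?mxE ?liftK.
by rewrite eqxx ?unlift_none.
Qed.

Lemma upd_consS n (t s : R) (y : 'rV[R]_n) (i : 'I_n) :
  upd (lift ord0 i) (cons_rV (t, y)) s = cons_rV (t, upd i y s).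
Proof.
apply/rowP => j; rewrite !mxE; case: (unliftP ord0 j) => [k|] ->.
  by rewrite (inj_eq lift_inj) ?liftK /= ?mxE ?liftK /= ?mxE.
by rewrite (negbTE (neq_lift _ _)) ?mxE ?unlift_none.
Qed.

Lemma measurable_upd n (i : 'I_n) (x : 'rV[R]_n) :
  measurable_fun [set: measurableTypeR R] (upd i x).
Proof.
apply: measurable_rV => j; rewrite /upd.
have [->|ji] := eqVneq j i.
  by under eq_fun do rewrite mxE eqxx; exact: measurable_id.
by under eq_fun do rewrite mxE (negbTE ji); exact: measurable_cst.
Qed.

Lemma measurable_cons_rVl n (t : R) :
  measurable_fun [set: 'rV[R]_n] (fun y => cons_rV (t, y)).
Proof. exact: (measurableT_comp (@measurable_cons_rV R n)). Qed.

Local Open Scope ereal_scope.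

Section tonelli.
Context n (h : 'rV[R]_n.+1 -> \bar R).
Hypothesis mh : measurable_fun [set: 'rV[R]_n.+1] h.
Hypothesis h0 : forall x, 0 <= h x.

Let mhc : measurable_fun [set: (measurableTypeR R * 'rV[R]_n)%type]
  (h \o @cons_rV R n).
Proof. exact: (measurableT_comp mh (@measurable_cons_rV R n)). Qed.

Let pushforwardE :
  \int[L n.+1]_x h x = \int[mu \x L n]_z (h \o @cons_rV R n) z.
Proof.
have := @ge0_integral_pushforward _ _ _ _ R _ (@measurable_cons_rV R n)
  (mu \x L n) setT h measurableT mh (fun x _ => h0 x).
by rewrite preimage_setT => <-.
Qed.

Lemma integral_rVS :
  \int[L n.+1]_x h x = \int[mu]_t \int[L n]_y h (cons_rV (t, y)).
Proof. by rewrite pushforwardE fubini_tonelli1//=. Qed.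

Lemma integral_rVS' :
  \int[L n.+1]_x h x = \int[L n]_y \int[mu]_t h (cons_rV (t, y)).
Proof. by rewrite pushforwardE fubini_tonelli2//=. Qed.

Lemma measurable_integral_slice :
  measurable_fun [set: measurableTypeR R]
    (fun t => \int[L n]_y h (cons_rV (t, y))).
Proof.
exact (@measurable_fun_fubini_tonelli_F _ _ _ _ R (L n) _ mhc (fun x => h0 _)).
Qed.

Lemma measurable_integral_line :
  measurable_fun [set: 'rV[R]_n] (fun y => \int[mu]_t h (cons_rV (t, y))).
Proof.
exact (@measurable_fun_fubini_tonelli_G _ _ _ _ R mu _ mhc (fun x => h0 _)).
Qed.

End tonelli.

(** Carries one-dimensional facts to R^n. Coordinates are peeled off in order: slices are compared
    by induction until direction [i] comes first, and then Tonelli puts the line integral inside. *)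
Lemma le_integral_lines n (i : 'I_n) (h1 h2 : 'rV[R]_n -> \bar R) :
  measurable_fun [set: 'rV[R]_n] h1 -> measurable_fun [set: 'rV[R]_n] h2 ->
  (forall x, 0 <= h1 x) -> (forall x, 0 <= h2 x) ->
  (forall x, \int[mu]_s h1 (upd i x s) <= \int[mu]_s h2 (upd i x s)) ->
  \int[L n]_x h1 x <= \int[L n]_x h2 x.
Proof.
elim: n i h1 h2 => [[]//|n IH] i h1 h2 m1 m2 p1 p2 H.
have mc h t : measurable_fun [set: 'rV[R]_n.+1] h ->
    measurable_fun [set: 'rV[R]_n] (fun y => h (cons_rV (t, y)) : \bar R).
  by move=> mh; exact: (measurableT_comp mh (measurable_cons_rVl _)).
case: (unliftP ord0 i) H => [j|] -> H.
  rewrite !integral_rVS//; apply: ge0_le_integral => //.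
  - by move=> t _; exact: integral_ge0.
  - exact: measurable_integral_slice.
  - exact: measurable_integral_slice.
  - move=> t _; apply: (IH j) => //; [exact: mc|exact: mc|move=> y].
    by have := H (cons_rV (t, y)); under eq_integral do rewrite upd_consS;
       under [leRHS]eq_integral do rewrite upd_consS.
rewrite !integral_rVS'//; apply: ge0_le_integral => //.
- by move=> y _; exact: integral_ge0.
- exact: measurable_integral_line.
- exact: measurable_integral_line.
- move=> y _; have := H (cons_rV (0%R, y)).
  by under eq_integral do rewrite upd_cons0;
     under [leRHS]eq_integral do rewrite upd_cons0.
Qed.

Lemma measurable_prod_rV n (phi : R -> \bar R) :
  measurable_fun [set: measurableTypeR R] phi ->
  measurable_fun [set: 'rV[R]_n] (fun x => \prod_(i < n) phi (x ord0 i)).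
Proof.
move=> mphi; elim: (index_enum _) => [|i s IH].
  by under eq_fun do rewrite big_nil; exact: measurable_cst.
under eq_fun do rewrite big_cons; apply: emeasurable_funM => //.
by apply: (measurableT_comp mphi); exact: measurable_coord.
Qed.

Lemma prode_ge0 (I : finType) (F : I -> \bar R) :
  (forall i, 0 <= F i) -> 0 <= \prod_(i : I) F i.
Proof.
by move=> F0; elim/big_ind : _ => // x y x0 y0; exact: mule_ge0.
Qed.

(** Both majorants used later, the indicator of a cube and the weight at the origin, are products
    over the coordinates, so one-dimensional integrals decide their finiteness. *)
Lemma integral_prod_rV n (phi : R -> \bar R) :
  measurable_fun [set: measurableTypeR R] phi -> (forall s, 0 <= phi s) ->
  \int[L n]_x (\prod_(i < n) phi (x ord0 i)) = (\int[mu]_s phi s) ^+ n.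
Proof.
move=> mphi phi0; elim: n => [|n IH].
  rewrite expe0 (_ : (fun x => _) = cst 1); last first.
    by apply/funext => x; rewrite big_ord0.
  by rewrite integral_cst//= mul1e diracT.
rewrite integral_rVS; last 2 first.
- exact: measurable_prod_rV.
- by move=> x; exact: prode_ge0.
rewrite expeS -IH -ge0_integralZr//=; last first.
  by apply: integral_ge0 => x _; exact: prode_ge0.
apply: eq_integral => t _; rewrite -ge0_integralZl//; last 2 first.
- exact: measurable_prod_rV.
- by move=> x _; exact: prode_ge0.
apply: eq_integral => y _; rewrite big_ord_recl !mxE unlift_none/=.
by congr (_ * _); apply: eq_bigr => i _; rewrite !mxE liftK.
Qed.

(** This discards the origin, where [hrho] vanishes and its powers take default values. *)
Lemma lebesgue_rV_hyperplane n :
  L n.+1 [set x : 'rV[R]_n.+1 | x ord0 ord0 = 0%R] = 0.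
Proof.
rewrite /= /lebesgue_step /pushforward.
rewrite (_ : _ @^-1` _ = [set 0%R] `*` [set: 'rV[R]_n]); last first.
  apply/seteqP; split => -[t y] /=; rewrite mxE unlift_none //=.
  by case.
by rewrite product_measure1E//= lebesgue_measure_set1 mul0e.
Qed.

End tonelli_rV.

(** * The Gagliardo-Nirenberg inequality *)

Section gagliardo.
Context {R : realType}.
Local Notation mu := (@lebesgue_measure R).
Local Notation L := lebesgue_rV.
Local Open Scope ereal_scope.

(* The Gagliardo-Nirenberg inequality in dual form: unlike the inequality for
   the norm of exponent [n / (n - 1)], it makes sense for [n = 1], and the
   weight [w] is what lets the slicing induction on the dimension close. *)
Definition gn_dual n := forall u g w : 'rV[R]_n -> R,
  measurable_fun [set: 'rV[R]_n] u -> measurable_fun [set: 'rV[R]_n] g ->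
  measurable_fun [set: 'rV[R]_n] w ->
  (forall x, 0 <= u x)%R -> (forall x, 0 <= g x)%R -> (forall x, 0 <= w x)%R ->
  (forall i x, (u x)%:E <= \int[mu]_s (g (upd i x s))%:E) ->
  \int[L n]_x (u x * w x `^ n%:R^-1)%:E <=
  (\int[L n]_x (g x)%:E) * (\int[L n]_x (w x)%:E) `^ n%:R^-1.

(** In dimension 1 the line through a point is the whole space, so [u] is bounded pointwise by the
    integral of [g], and the exponent of the last factor is 1. *)
Lemma gn_dual1 : gn_dual 1.
Proof.
move=> u g w mu_ mg mw u0 g0 w0 ug.
have gE (x : 'rV[R]_1) :
    \int[mu]_s (g (upd ord0 x s))%:E = \int[L 1]_x (g x)%:E.
  rewrite integral_rVS'; last 2 first.
  - exact/measurable_EFinP.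
  - by move=> y; rewrite lee_fin.
  rewrite [RHS]/= integral_dirac//= ?diracT ?mul1e.
    apply: eq_integral => s _; congr (g _)%:E; apply/rowP => j.
    by rewrite !mxE (ord1 j) eqxx unlift_none.
  have /measurable_EFinP mg' := mg.
  apply: (measurable_integral_line mg') => z.
  by rewrite lee_fin.
rewrite invr1 poweRe1; last by apply: integral_ge0 => x _; rewrite lee_fin.
rewrite -ge0_integralZl//; first last.
- by apply: integral_ge0 => x _; rewrite lee_fin.
- by move=> x _; rewrite lee_fin.
- exact/measurable_EFinP.
apply: ge0_le_integral => //.
- by move=> x _; rewrite lee_fin mulr_ge0// powR_ge0.
- apply/measurable_EFinP; apply: measurable_funM => //.
  exact: (measurableT_comp (measurable_powR _)).
- by apply: emeasurable_funM => //; exact/measurable_EFinP.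
- move=> x _; rewrite powRr1// EFinM lee_wpmul2r ?lee_fin//.
  by rewrite -(gE x).
Qed.

Lemma gn_of_dual n : gn_dual n.+1 -> forall u g : 'rV[R]_n.+2 -> R,
  measurable_fun [set: 'rV[R]_n.+2] u -> measurable_fun [set: 'rV[R]_n.+2] g ->
  (forall x, 0 <= u x)%R -> (forall x, 0 <= g x)%R ->
  (forall i x, (u x)%:E <= \int[mu]_s (g (upd i x s))%:E) ->
  \int[L n.+2]_x (u x `^ (1 + n.+1%:R^-1))%:E <=
  (\int[L n.+2]_x (g x)%:E) `^ (1 + n.+1%:R^-1).
Proof.
move=> Nn u g mu_ mg u0 g0 ug.
set p := n.+1%:R^-1%R; have p0 : (0 < p)%R by rewrite invr_gt0 ltr0n.
set G := \int[L n.+2]_x (g x)%:E.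
have G0 : 0 <= G by apply: integral_ge0 => x _; rewrite lee_fin.
have [->|Goo] := eqVneq G +oo.
  by rewrite poweRyr ?leey// gt_eqF// addr_gt0.
have mgE : measurable_fun [set: 'rV[R]_n.+2] (EFin \o g) by exact/measurable_EFinP.
have gE0 x : 0 <= (EFin \o g) x by rewrite lee_fin.
pose P y := \int[mu]_t (g (cons_rV (t, y)))%:E.
have P0 y : 0 <= P y by apply: integral_ge0 => t _; rewrite lee_fin.
have mP : measurable_fun [set: 'rV[R]_n.+1] P.
  exact: (measurable_integral_line mgE gE0).
have GP : G = \int[L n.+1]_y P y by rewrite /G integral_rVS'.
have iP : (L n.+1).-integrable setT P.
  apply/integrableP; split => //.
  by under eq_integral do rewrite gee0_abs//; rewrite -GP ltey.
(* The dual inequality takes real weights. Where [P] is infinite, [W] is 0 and no longer dominates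
   [u]; as [G] is finite this happens on a null set only, hence the almost everywhere comparison
   below. *)
pose W y := fine (P y).
have W0 y : (0 <= W y)%R by rewrite /W fine_ge0.
have mW : measurable_fun [set: 'rV[R]_n.+1] W by exact: measurableT_comp.
have WG : \int[L n.+1]_y (W y)%:E <= G.
  rewrite GP; apply: ge0_le_integral => //.
  - by move=> y _; rewrite lee_fin.
  - exact/measurable_EFinP.
  - move=> y _; rewrite /W; have [/fineK ->//|] := boolP (P y \is a fin_num).
    by rewrite ge0_fin_numE// -leNgt leye_eq => /eqP ->; rewrite leey.
have mup : measurable_fun [set: 'rV[R]_n.+2] (fun x => u x `^ (1 + p))%R.
  exact: (measurableT_comp (measurable_powR _)).
rewrite integral_rVS; last 2 first.
- exact/measurable_EFinP.
- by move=> x; rewrite lee_fin powR_ge0.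
have mslice (h : 'rV[R]_n.+2 -> R) t : measurable_fun [set: 'rV[R]_n.+2] h ->
    measurable_fun [set: 'rV[R]_n.+1] (fun y => h (cons_rV (t, y))).
  by move=> mh; exact: (measurableT_comp mh (measurable_cons_rVl _)).
apply: (@le_trans _ _
    (\int[mu]_t (\int[L n.+1]_y (g (cons_rV (t, y)))%:E * G `^ p))).
  apply: ge0_le_integral => //.
  - by move=> t _; apply: integral_ge0 => y _; rewrite lee_fin powR_ge0.
  - apply: (@measurable_integral_slice _ _ (fun x => (u x `^ (1 + p))%:E)).
      exact/measurable_EFinP.
    by move=> x; rewrite lee_fin powR_ge0.
  - apply: emeasurable_funM => //; apply: (measurable_integral_slice mgE gE0).
  move=> t _.
  apply: (@le_trans _ _
      (\int[L n.+1]_y (u (cons_rV (t, y)) * W y `^ p)%:E)).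
    apply: ae_ge0_le_integral => //.
    + by move=> y _; rewrite lee_fin powR_ge0.
    + by apply/measurable_EFinP; exact: (mslice (fun x => u x `^ (1 + p))%R).
    + by move=> y _; rewrite lee_fin mulr_ge0// powR_ge0.
    + apply/measurable_EFinP; apply: measurable_funM; first exact: mslice.
      exact: (measurableT_comp (measurable_powR _)).
    + apply: filterS (integrable_ae measurableT iP) => y /(_ I) Pfin _.
      have uW : (u (cons_rV (t, y)) <= W y)%R.
        rewrite -lee_fin /W fineK//.
        apply: le_trans (ug ord0 (cons_rV (t, y))) _.
        by under eq_integral do rewrite upd_cons0.
      rewrite lee_fin powRD; last by rewrite gt_eqF// addr_gt0.
      rewrite powRr1// ler_wpM2l//; apply: ge0_ler_powR; rewrite ?nnegrE//.
      exact: ltW.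
  have ugt i y : (u (cons_rV (t, y)))%:E <=
      \int[mu]_s (g (cons_rV (t, upd i y s)))%:E.
    have := ug (lift ord0 i) (cons_rV (t, y)).
    by under eq_integral do rewrite upd_consS.
  have := Nn (fun y => u (cons_rV (t, y))) (fun y => g (cons_rV (t, y))) W
    (mslice _ _ mu_) (mslice _ _ mg) mW (fun=> u0 _) (fun=> g0 _) W0 ugt.
  move=> /le_trans; apply.
  - rewrite lee_wpmul2l//.
      by apply: integral_ge0 => y _; rewrite lee_fin.
    apply: gt0_ler_poweR; rewrite ?in_itv/= ?leey ?andbT ?(ltW p0)//.
    by apply: integral_ge0 => y _; rewrite lee_fin.
rewrite ge0_integralZr//.
- have <- : G = \int[mu]_t \int[L n.+1]_y (g (cons_rV (t, y)))%:E.
    exact: (integral_rVS mgE gE0).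
  rewrite poweRD ?poweRe1//.
  by apply: add_neq0_poweRD_def; rewrite gt_eqF// addr_gt0.
- exact: (measurable_integral_slice mgE gE0).
- by move=> t _; apply: integral_ge0 => y _; rewrite lee_fin.
- exact: poweR_ge0.
Qed.

(** Hoelder's inequality with exponents (n+2)/(n+1) and n+2. The first factor is bounded by the
    Gagliardo-Nirenberg inequality that the dual form one dimension below has just provided. *)
Lemma gn_dualS n : gn_dual n.+1 -> gn_dual n.+2.
Proof.
move=> Nn u g w mu_ mg mw u0 g0 w0 ug.
have := gn_of_dual Nn mu_ mg u0 g0 ug.
set p := (1 + n.+1%:R^-1 : R)%R => uG.
have p0 : (0 < p)%R by rewrite addr_gt0// invr_gt0 ltr0n.
set r := n.+2%:R^-1%R; have r0 : (0 < r)%R by rewrite invr_gt0 ltr0n.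
have pr : (p^-1 + r = 1)%R.
  rewrite /p /r; have n1 : n.+1%:R != 0%R :> R by rewrite pnatr_eq0.
  have n2 : n.+2%:R != 0%R :> R by rewrite pnatr_eq0.
  have n12 : (n.+2%:R = n.+1%:R + 1 :> R)%R by rewrite -addn1 natrD.
  rewrite n12 in n2 *; move: n1 n2; move: (n.+1%:R : R) => a a0 a1.
  by field; rewrite a0 a1.
have mwr : measurable_fun [set: 'rV[R]_n.+2] (fun x => w x `^ r)%R.
  exact: (measurableT_comp (measurable_powR _)).
have := @hoelder _ _ _ (L n.+2) u (fun x => w x `^ r)%R p r^-1 mu_ mwr p0.
rewrite invr_gt0 invrK => /(_ r0 pr).
rewrite Lnorm1; under eq_integral => x _.
  rewrite /= ger0_norm; last by rewrite mulr_ge0// powR_ge0.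
  over.
move=> /le_trans; apply.
rewrite unlock invrK.
under [X in _ * X `^ _]eq_integral => x _.
  rewrite /= ger0_norm ?powR_ge0// -powRrM mulfV ?gt_eqF// powRr1//. over.
rewrite lee_wpmul2r ?poweR_ge0//.
under eq_integral => x _ do rewrite /= ger0_norm//.
set A := integral _ _ _ in uG *; set B := integral _ _ _ in uG *.
have AB : (A `^ p^-1 <= (B `^ p) `^ p^-1).
  apply: gt0_ler_poweR; rewrite ?in_itv/= ?leey ?andbT ?poweR_ge0//.
    by rewrite invr_ge0 ltW.
  by apply: integral_ge0 => x _; rewrite lee_fin powR_ge0.
apply: le_trans AB _; rewrite -poweRrM mulfV ?gt_eqF// poweRe1//.
by apply: integral_ge0 => x _; rewrite lee_fin.
Qed.

Lemma gn_dualP n : gn_dual n.+1.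
Proof. by elim: n => [|n]; [exact: gn_dual1|exact: gn_dualS]. Qed.

Lemma gagliardo_nirenberg n (u g : 'rV[R]_n.+2 -> R) :
  measurable_fun [set: 'rV[R]_n.+2] u -> measurable_fun [set: 'rV[R]_n.+2] g ->
  (forall x, 0 <= u x)%R -> (forall x, 0 <= g x)%R ->
  (forall i x, (u x)%:E <= \int[mu]_s (g (upd i x s))%:E) ->
  \int[L n.+2]_x (u x `^ (1 + n.+1%:R^-1))%:E <=
  (\int[L n.+2]_x (g x)%:E) `^ (1 + n.+1%:R^-1).
Proof. exact/gn_of_dual/gn_dualP. Qed.

End gagliardo.

(** * Integrals of derivatives on the line *)

Section line_integrals.
Context {R : realType}.
Local Notation mu := (@lebesgue_measure R).
Local Open Scope ereal_scope.

Lemma derive_FTC (v v' : R -> R) (a b : R) : (a < b)%R ->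
  (forall s, is_derive s (1%R : R) v (v' s)) -> continuous v' ->
  \int[mu]_(s in `[a, b]) (v' s)%:E = (v b - v a)%:E.
Proof.
move=> ab dv cv'.
have cv : continuous v.
  move=> s; apply/differentiable_continuous/derivable1_diffP.
  by have [] := dv s.
rewrite (@continuous_FTC2 _ v' v) ?EFinB//.
- exact: continuous_subspaceT.
- split => //.
  + by apply: cvg_at_right_filter; exact: cv.
  + by apply: cvg_at_left_filter; exact: cv.
- by move=> s _; rewrite derive1E; have [_ ->] := dv s.
Qed.

Section compact_support.
Variables v v' : R -> R.
Hypotheses (dv : forall s, is_derive s (1%R : R) v (v' s)) (cv' : continuous v').
Hypotheses (v0 : forall s, (1 <= `|s|)%R -> v s = 0%R).
Hypotheses (v'0 : forall s, (1 <= `|s|)%R -> v' s = 0%R).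

Let mv' : measurable_fun [set: measurableTypeR R] v'.
Proof. exact: continuous_measurable_fun. Qed.

Lemma le_integral_derive s : `|v s|%:E <= \int[mu]_t `|v' t|%:E.
Proof.
have [/v0 ->|] := leP 1%R `|s|%R.
  by rewrite normr0; apply: integral_ge0 => t _; rewrite lee_fin.
rewrite ltr_norml => /andP[s1 _].
have /= := derive_FTC s1 dv cv'.
rewrite (v0 (s := (-1)%R)) ?normrN1// subr0 => vE.
rewrite -abse_EFin -vE.
apply: le_trans (le_abse_integral _ _ _) _ => //=.
  by apply/measurable_EFinP; exact: measurable_funTS.
rewrite (_ : (fun x => _) = fun x => `|v' x|%:E)//.
apply: ge0_subset_integral => //.
- by apply/measurable_EFinP; exact: measurableT_comp.
Qed.

(** By the fundamental theorem of calculus on [-1, 1] the integral of [v'] is 0. Both parts are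
    finite there, so the difference can be turned into an equality. *)
Lemma integral_derive_posneg :
  \int[mu]_t (Num.max (v' t) 0)%:E = \int[mu]_t (Num.max (- v' t) 0)%:E.
Proof.
pose D := `[(-1)%R, 1%R]%classic : set R.
have D1 t : ~ D t -> (1 <= `|t|)%R.
  rewrite leNgt => Dt; apply/negP; rewrite ltr_norml => /andP[t1 t2].
  by apply: Dt; rewrite /D/= in_itv/= !ltW.
have iv : mu.-integrable D (EFin \o v').
  apply: continuous_compact_integrable; first exact: segment_compact.
  exact: continuous_subspaceT.
have ltN11 : (-1 < 1 :> R)%R by lra.
have := derive_FTC ltN11 dv cv'.
rewrite !v0 ?normrN1 ?normr1// subrr integralE => /eqP.
have mD : measurable (D : set (measurableTypeR R)) by exact: measurable_itv.
have /= fp := integrable_pos_fin_num mD iv.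
have /= fn := integrable_neg_fin_num mD iv.
rewrite sube_eq//.
rewrite add0e => /eqP.
suff E (w : R -> R) : (forall t, (1 <= `|t|)%R -> w t = 0%R) ->
    \int[mu]_t (Num.max (w t) 0)%:E = \int[mu]_(t in D) (EFin \o w)^\+ t.
  rewrite (E v')// (E (fun t => - v' t)%R) => [->|t t1]; last by rewrite v'0// oppr0.
  by apply: eq_integral => t _; rewrite funenegE funeposE/=.
move=> w0; rewrite [RHS]integral_mkcond; apply: eq_integral => t _.
rewrite patchE; case: ifPn => [_|/negP]; first by rewrite funeposE EFin_max.
by rewrite inE => /D1/w0 ->; rewrite maxxx.
Qed.

End compact_support.
End line_integrals.

(** * Continuously differentiable functions with compact support in the ball *)

Section continuous_rV.
Context {R : realType} {n : nat}.

(** The sigma-algebra is generated by the coordinates, so an open set is exhibited as a countable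
    union of boxes with rational centres and radii 1/(k+1). *)
Lemma open_measurable_rV (U : set 'rV[R]_n) : open U -> measurable U.
Proof.
move=> oU.
pose box (p : 'rV[rat]_n * nat) := [set x : 'rV[R]_n |
  forall j, `|ratr (p.1 ord0 j) - x ord0 j| < p.2.+1%:R^-1].
have mbox p : measurable (box p).
  rewrite (_ : box p = \bigcap_(j in [set: 'I_n])
      ((fun x : 'rV[R]_n => x ord0 j) @^-1`
         ball (ratr (p.1 ord0 j) : R) p.2.+1%:R^-1)).
    apply: fin_bigcap_measurable => // j _; rewrite -[_ @^-1` _]setTI.
    apply: measurable_coord => //.
    by apply: open_measurable; exact: ball_open.
  by apply/seteqP; split => x /= H j => [_|]; exact: H.
rewrite (_ : U = \bigcup_(p in [set p | box p `<=` U]) box p).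
  rewrite bigcup_mkcond; apply: countable_bigcupT_measurable => [|p].
    exact: countableP.
  by case: ifP.
apply/seteqP; split => [x Ux|x [p /= pU]]; last exact: pU.
have /nbhs_ballP[r /= r0 rU] := open_nbhs_nbhs (conj oU Ux).
(* Twice the radius stays below [r], so a box containing [x] lies in the ball of radius [r] around
   [x]. *)
have [k kr] : exists k, k.+1%:R^-1 + k.+1%:R^-1 < r.
  exists (Num.truncn (r / 2)^-1); rewrite [r in ltRHS]splitr ltrD//;
    by rewrite invf_plt ?posrE ?divr_gt0// truncnS_gt.
have rat_near j : {q : rat | `|ratr q - x ord0 j| < k.+1%:R^-1}.
  have xk : x ord0 j - k.+1%:R^-1 < x ord0 j + k.+1%:R^-1.
    by rewrite ltrBlDr -addrA ltrDl addr_gt0// invr_gt0.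
  have /cid[q] := rat_in_itvoo xk.
  by rewrite in_itv/= => qx; exists q; rewrite ltr_distl.
pose q : 'rV[rat]_n := \row_j sval (rat_near j).
exists (q, k) => /=.
  move=> y yq; apply: rU; split => // i j; rewrite (ord1 i).
  have xq := svalP (rat_near j); have := yq j; rewrite mxE => yq'.
  rewrite /ball/=; apply: le_lt_trans kr.
  rewrite -(subrKA (ratr (sval (rat_near j)))).
  rewrite (le_trans (ler_normD _ _))// lerD// ltW//.
  by rewrite distrC.
by move=> j; rewrite mxE; exact: (svalP (rat_near j)).
Qed.

Lemma continuous_measurable_rV (f : 'rV[R]_n -> R) :
  continuous f -> measurable_fun [set: 'rV[R]_n] f.
Proof.
move=> cf; apply: (measurability _ (RGenOInfty.measurableE R)) => //.
move=> _ [_ [a ->] <-]; rewrite setTI; apply: open_measurable_rV.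
by apply: open_comp => //; exact: open_gt.
Qed.

End continuous_rV.

Section C1_compact.
Context {R : realType} {n : nat}.
Implicit Types (x y : 'rV[R]_n) (i : 'I_n).

Lemma upd_id i x : upd i x (x ord0 i) = x.
Proof. by apply/rowP => j; rewrite mxE; case: eqVneq => // ->. Qed.

Lemma upd_val i x (s : R) : upd i x s ord0 i = s.
Proof. by rewrite mxE eqxx. Qed.

Lemma upd_other i j x (s : R) : j != i -> upd i x s ord0 j = x ord0 j.
Proof. by rewrite mxE => /negbTE ->. Qed.

Lemma continuous_upd i x : continuous (upd i x : R -> 'rV[R]_n).
Proof.
move=> s; apply/cvg_ballP => e e0; near=> t; split => // a j; rewrite !mxE.
case: eqVneq => _; last exact: ballxx.
by near: t; exact: (@nbhsx_ballx R R).
Unshelve. all: by end_near. Qed.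

Lemma normsq_ge0 x : 0 <= \sum_j x ord0 j ^+ 2.
Proof. by apply: sumr_ge0 => j _; exact: sqr_ge0. Qed.

Lemma enorm_sq x : enorm x ^+ 2 = \sum_j x ord0 j ^+ 2.
Proof. by rewrite sqr_sqrtr// normsq_ge0. Qed.

Lemma hballE x : hball x <-> \sum_j x ord0 j ^+ 2 < 1.
Proof.
rewrite /hball/= -enorm_sq; split => x1.
  by rewrite expr_lt1// sqrtr_ge0.
by rewrite -(@expr_lt1 _ 2)// sqrtr_ge0.
Qed.

Lemma coord_le_enorm x i : `|x ord0 i| <= enorm x.
Proof.
rewrite -sqrtr_sqr ler_wsqrtr// (bigD1 i)//= lerDl.
by apply: sumr_ge0 => j _; exact: sqr_ge0.
Qed.

Lemma hball_coord x i : hball x -> `|x ord0 i| < 1.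
Proof. exact/le_lt_trans/coord_le_enorm. Qed.

Lemma continuous_normsq : continuous (fun x => \sum_j x ord0 j ^+ 2).
Proof.
apply: continuous_big => [|j _ x]; first exact: add_continuous.
by apply: (@continuous_comp _ _ _ (fun x : 'rV[R]_n => x ord0 j) (fun t : R => t ^+ 2));
  [exact: coord_continuous|exact: exprn_continuous].
Qed.

Variable K : set 'rV[R]_n.
Hypotheses (cK : compact K) (KB : K `<=` hball).

(** Derivatives are taken along coordinate lines only, which is all that the fundamental theorem and
    Tonelli use. The derivatives are data, so that products and compositions come with explicit
    formulas. *)
Record C1c (f : 'rV[R]_n -> R) (f' : 'I_n -> 'rV[R]_n -> R) : Prop := MkC1c {
  C1c_continuous : continuous f;
  C1c_continuous' : forall i, continuous (f' i);
  C1c_derive : forall i x (s : R),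
    is_derive s (1 : R) (fun s => f (upd i x s)) (f' i (upd i x s));
  C1c_supp : forall x, ~ K x -> f x = 0 }.

Let clK : closed K.
Proof. by apply: compact_closed => //; exact: norm_hausdorff. Qed.

Lemma near_notK x : ~ K x -> \forall y \near x, ~ K y.
Proof. by move=> Kx; apply: open_nbhs_nbhs; split=> //; exact: closed_openC. Qed.

Lemma C1c_supp' f f' : C1c f f' -> forall i x, ~ K x -> f' i x = 0.
Proof.
move=> cf i x Kx; have := C1c_derive cf i x (x ord0 i); rewrite upd_id => df.
have : is_derive (x ord0 i) (1 : R) (fun s => f (upd i x s)) 0.
  have : is_derive (x ord0 i) (1 : R) (cst (0 : R)) 0 by exact: is_derive_cst.
  apply: near_eq_is_derive.
  have := @continuous_upd i x (x ord0 i); rewrite /continuous_at upd_id.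
  move=> /(_ _ (near_notK Kx)) Kn.
  have {}Kn : \forall s \near x ord0 i, ~ K (upd i x s) by exact: Kn.
  apply: filterS Kn => s Ks /=.
  by rewrite (C1c_supp cf).
by case: df => _ <- [_ ->].
Qed.

Lemma measurable_C1c f f' : C1c f f' -> measurable_fun [set: 'rV[R]_n] f.
Proof. by move=> cf; apply: continuous_measurable_rV; exact: (C1c_continuous cf). Qed.

Lemma measurable_C1c' f f' i : C1c f f' -> measurable_fun [set: 'rV[R]_n] (f' i).
Proof. by move=> cf; apply: continuous_measurable_rV; exact: (C1c_continuous' cf). Qed.

Lemma C1c_comp f f' (phi phi' : R -> R) : C1c f f' ->
  (forall s : R, is_derive s (1 : R) phi (phi' s)) -> continuous phi' -> phi 0 = 0 ->
  C1c (phi \o f) (fun i x => phi' (f x) * f' i x).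
Proof.
move=> cf dphi cphi' phi0; split.
- move=> x; apply: continuous_comp; first exact: (C1c_continuous cf).
  by apply/differentiable_continuous/derivable1_diffP; have [] := dphi (f x).
- move=> i x; have cx : {for x, continuous (phi' \o f)}.
    by apply: continuous_comp; [exact: (C1c_continuous cf)|exact: cphi'].
  exact: (continuousM cx (@C1c_continuous' _ _ cf i x)).
- move=> i x s.
  exact: (@is_derive1_comp _ phi (fun s => f (upd i x s)) s _ _ (dphi _)
    (C1c_derive cf i x s)).
- by move=> x /(C1c_supp cf) /= ->.
Qed.

(** Off the closed set [K] the product vanishes on a whole neighbourhood, so [E] may be arbitrary
    outside the ball, as [e_] is. *)
Lemma continuous_mul_supp (f E : 'rV[R]_n -> R) : continuous f ->
  (forall x, ~ K x -> f x = 0) -> (forall x, hball x -> {for x, continuous E}) ->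
  continuous (fun x => f x * E x).
Proof.
move=> cf f0 cE; suff H (x : 'rV[R]_n) : {for x, continuous (fun x => f x * E x)}.
  by move=> x; exact: H.
have [Kx|Kx] := pselect (K x).
  by apply: continuousM; [exact: cf|exact/cE/KB].
suff : f y * E y @[y --> x] --> f x * E x by [].
have Kn := near_notK Kx; rewrite f0// mul0r; apply: cvg_near_cst; first exact: (nbhs_filter x).
by apply: (@filterS _ _ (nbhs_filter x) _ _ _ Kn) => y /f0 ->; rewrite mul0r.
Qed.

Lemma C1c_mul f f' (E : 'rV[R]_n -> R) (E' : 'I_n -> 'rV[R]_n -> R) :
  C1c f f' -> (forall x, hball x -> {for x, continuous E}) ->
  (forall i x, hball x -> {for x, continuous (E' i)}) ->
  (forall i x (s : R), hball (upd i x s) ->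
    is_derive s (1 : R) (fun s => E (upd i x s)) (E' i (upd i x s))) ->
  C1c (fun x => f x * E x) (fun i x => f' i x * E x + f x * E' i x).
Proof.
move=> cf cE cE' dE; split.
- exact: (continuous_mul_supp (@C1c_continuous _ _ cf) (C1c_supp cf) cE).
- move=> i.
  have c1 := continuous_mul_supp (@C1c_continuous' _ _ cf i) (C1c_supp' cf i) cE.
  have c2 := continuous_mul_supp (@C1c_continuous _ _ cf) (C1c_supp cf) (cE' i).
  by move=> x; exact: (continuousD (c1 x) (c2 x)).
- move=> i x s; have [Kx|Kx] := pselect (K (upd i x s)).
    have df := C1c_derive cf i x s; have dEs := dE i x s (KB Kx).
    have := is_deriveM df dEs.
    by rewrite /GRing.scale/= addrC [_ * f' _ _]mulrC.
  rewrite (C1c_supp cf)// (C1c_supp' cf)// !mul0r addr0.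
  have : is_derive s (1 : R) (cst (0 : R)) 0 by exact: is_derive_cst.
  apply: near_eq_is_derive.
  have Kn : \forall t \near s, ~ K (upd i x t).
    exact: (@continuous_upd i x s _ (near_notK Kx)).
  by apply: filterS Kn => t Kt /=; rewrite (C1c_supp cf)// mul0r.
- by move=> x /(C1c_supp cf) ->; rewrite mul0r.
Qed.

End C1_compact.

(** * Powers of the conformal factor and integrals over the ball *)

Section C1_integrals.
Context {R : realType}.
Local Notation mu := (@lebesgue_measure R).
Local Notation L := lebesgue_rV.

(* [e_ x] is the conformal factor up to a constant; it is negative, or junk on
   the unit sphere, outside the ball, where only [`|e_ x|] is integrated, against
   functions that vanish there. *)
Definition e_ n (x : 'rV[R]_n) : R := (1 - \sum_j x ord0 j ^+ 2)^-1.

Lemma e_gt0 n (x : 'rV[R]_n) : hball x -> 0 < e_ x.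
Proof. by move=> /hballE x1; rewrite invr_gt0 subr_gt0. Qed.

Section weights.
Context {n : nat}.
Implicit Types (x y : 'rV[R]_n) (i j : 'I_n).

Lemma continuous_e x : hball x -> {for x, continuous (@e_ n)}.
Proof.
move=> /hballE x1; apply: continuousV; first by rewrite subr_eq0 gt_eqF.
apply: continuousB; first exact: cst_continuous.
exact: continuous_normsq.
Qed.

Lemma continuous_eX k x : hball x -> {for x, continuous (fun y => e_ y ^+ k)}.
Proof.
move=> xB; apply: (@continuous_comp _ _ _ (@e_ n) (fun t : R => t ^+ k)).
  exact: continuous_e.
exact: exprn_continuous.
Qed.

Definition e_X' k i x : R := (2 * k)%:R * x ord0 i * e_ x ^+ k.+1.

Lemma continuous_eX' k i x : hball x -> {for x, continuous (e_X' k i)}.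
Proof.
move=> xB; apply: continuousM; last exact: continuous_eX.
apply: continuousM; first exact: cst_continuous.
exact: coord_continuous.
Qed.

Lemma normsq_upd i x s : \sum_j upd i x s ord0 j ^+ 2 =
  s ^+ 2 + \sum_(j | j != i) x ord0 j ^+ 2.
Proof.
rewrite (bigD1 i)//= upd_val; congr (_ + _).
by apply: eq_bigr => j ji; rewrite upd_other.
Qed.

Lemma is_derive_eX k i x (s : R) : hball (upd i x s) ->
  is_derive s (1 : R) (fun s => e_ (upd i x s) ^+ k) (e_X' k i (upd i x s)).
Proof.
move=> /hballE; set c := \sum_(j | j != i) x ord0 j ^+ 2.
rewrite normsq_upd -/c => sB.
have t0 : 1 - (s ^+ 2 + c) != 0 by rewrite subr_eq0 gt_eqF.
rewrite (_ : (fun s => _) = (fun s => (1 - (s ^+ 2 + c))^-1) ^+ k); last first.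
  by apply/funext => t; rewrite /e_ normsq_upd -/c fctE.
have d1 : is_derive s (1 : R) (fun s => 1 - (s ^+ 2 + c)) (- (2 * s)).
  have := @is_deriveB R R R (cst 1) (fun s => s ^+ 2 + c) s 1 _ _
    (is_derive_cst _ _ _)
    (@is_deriveD R R R (fun s => s ^+ 2) (cst c) s 1 _ _
      (@is_deriveX R R id 2 s 1 1 (is_derive_id _ _)) (is_derive_cst _ _ _)).
  by rewrite /GRing.scale/= expr1 mulr1 addr0 sub0r; exact.
have := @is_deriveX R R (fun s => (1 - (s ^+ 2 + c))^-1) k s 1 _
  (@is_deriveV R (fun s => 1 - (s ^+ 2 + c)) s (- (2 * s)) 1 t0 d1).
move=> H; apply: (is_derive_eq H); clear H; rewrite /e_X' /e_ normsq_upd -/c upd_val /GRing.scale/=.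
case: k => [|k] /=; first by rewrite ?muln0 !mul0r.
rewrite natrM exprS -!exprVn !exprS expr0.
ring.
Qed.

Lemma is_derive_coord i j x (s : R) : is_derive s (1 : R)
  (fun s => upd j x s ord0 i) (i == j)%:R.
Proof.
have [->|ij] := eqVneq i j.
  by under eq_fun do rewrite upd_val; exact: is_derive_id.
by under eq_fun do rewrite upd_other//; exact: is_derive_cst.
Qed.

End weights.

Section integrals.
Context {n : nat} (K : set 'rV[R]_n).
Hypotheses (cK : compact K) (KB : K `<=` hball).
Local Open Scope ereal_scope.

(** [h] is bounded, and [K] lies in the cube with sides [-1, 1]. *)
Lemma integral_lt_supp (h : 'rV[R]_n -> R) : continuous h ->
  (forall x, ~ K x -> h x = 0%R) -> \int[L n]_x `|h x|%:E < +oo.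
Proof.
move=> ch h0.
have [M [_ MK]] : bounded_set (h @` K).
  by apply: compact_bounded; apply: continuous_compact => //; exact: continuous_subspaceT.
pose C := (`|M| + 1)%R.
have C0 : (0 <= C)%R by rewrite addr_ge0.
have hC x : (`|h x| <= C)%R.
  have [Kx|/h0 ->] := pselect (K x); last by rewrite normr0.
  apply: (MK C); last by exists x.
  by rewrite (le_lt_trans (ler_norm _))// ltrDl.
pose phi (s : R) : \bar R := (\1_(`[(-1)%R, 1%R] : set R) s)%:E.
have mphi : measurable_fun [set: measurableTypeR R] phi.
  by apply/measurable_EFinP; apply: measurable_indic; exact: measurable_itv.
have phi0 s : 0 <= phi s by rewrite lee_fin.
have : \int[L n]_x `|h x|%:E <= \int[L n]_x (C%:E * \prod_(i < n) phi (x ord0 i)).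
  apply: ge0_le_integral => //.
  - apply/measurable_EFinP; apply: measurableT_comp => //.
    exact: continuous_measurable_rV.
  - by apply: emeasurable_funM => //; exact: measurable_prod_rV.
  - move=> x _; have [Kx|/h0 ->] := pselect (K x); last first.
      by rewrite normr0 mule_ge0 ?prode_ge0// lee_fin.
    rewrite big1 ?mule1 ?lee_fin// => i _.
    rewrite /phi indicE mem_set//= in_itv/= -ler_norml.
    by rewrite ltW// hball_coord//; exact: KB.
move=> /le_lt_trans; apply.
rewrite ge0_integralZl//; last 2 first.
- exact: measurable_prod_rV.
- by move=> x _; exact: prode_ge0.
have phiE : \int[mu]_s phi s = (1 + 1)%:E.
  rewrite integral_indic ?setIT//.
  have := @lebesgue_measure_itv R `[(-1)%R, 1%R].
  by rewrite /= lte_fin gtrN// -EFinD opprK.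
rewrite integral_prod_rV// phiE.
by rewrite -EFin_expe -EFinM ltry.
Qed.

Variables (u : 'rV[R]_n -> R) (u' : 'I_n -> 'rV[R]_n -> R).
Hypothesis cu : C1c K u u'.

Let supp_out (h : 'rV[R]_n -> R) i x s : (forall x, ~ K x -> h x = 0%R) ->
  (1 <= `|s|)%R -> h (upd i x s) = 0%R.
Proof.
move=> h0 s1; apply: h0 => /KB /(hball_coord i).
by rewrite upd_val ltNge s1.
Qed.

Let cline i x : continuous (fun s : R => u' i (upd i x s)).
Proof.
move=> s.
apply: (@continuous_comp _ _ _ (upd i x : R -> 'rV[R]_n) (u' i)).
  exact: continuous_upd.
exact: (C1c_continuous' cu).
Qed.

Lemma C1c_le_line i x :
  `|u x|%:E <= \int[mu]_s `|u' i (upd i x s)|%:E.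
Proof.
have := @le_integral_derive R (fun s => u (upd i x s))
  (fun s => u' i (upd i x s)) (C1c_derive cu i x) (@cline i x).
move=> /(_ _ (x ord0 i)); rewrite upd_id; apply.
by move=> s s1; apply: supp_out => //; exact: C1c_supp cu.
Qed.

(** The equality holds on every line in direction [i]; [le_integral_lines] is applied both ways. *)
Lemma C1c_integral_posneg i :
  \int[L n]_x (Num.max (u' i x) 0)%:E = \int[L n]_x (Num.max (- u' i x) 0)%:E.
Proof.
have mu' := measurable_C1c' i cu.
have E x : \int[mu]_s (Num.max (u' i (upd i x s)) 0)%:E =
    \int[mu]_s (Num.max (- u' i (upd i x s)) 0)%:E.
  apply: (@integral_derive_posneg R (fun s => u (upd i x s))
    (fun s => u' i (upd i x s)) (C1c_derive cu i x) (@cline i x)).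
  - by move=> s s1; apply: supp_out => //; exact: C1c_supp cu.
  - by move=> s s1; apply: supp_out => //; exact: (C1c_supp' cK cu).
have m1 : measurable_fun [set: 'rV[R]_n] (fun x => (Num.max (u' i x) 0)%:E).
  by apply/measurable_EFinP; exact: measurable_maxr.
have m2 : measurable_fun [set: 'rV[R]_n] (fun x => (Num.max (- u' i x) 0)%:E).
  apply/measurable_EFinP; apply: measurable_maxr => //.
  exact: measurableT_comp.
by apply/eqP; rewrite eq_le; apply/andP; split; apply: (@le_integral_lines _ _ i) => //;
  move=> x; rewrite ?E// lee_fin le_max lexx orbT.
Qed.

End integrals.

Lemma C1c_gagliardo_nirenberg n (K : set 'rV[R]_n.+2) u u' (G : 'rV[R]_n.+2 -> R) :
  compact K -> K `<=` hball -> C1c K u u' ->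
  measurable_fun [set: 'rV[R]_n.+2] G -> (forall i x, `|u' i x| <= G x) ->
  (\int[L n.+2]_x (`|u x| `^ (1 + n.+1%:R^-1))%:E <=
   (\int[L n.+2]_x (G x)%:E) `^ (1 + n.+1%:R^-1))%E.
Proof.
move=> cK KB cu mG uG; apply: gagliardo_nirenberg => //.
- by apply: measurableT_comp => //; exact: measurable_C1c cu.
- by move=> x; apply: (le_trans _ (uG ord0 x)).
- move=> i x; apply: le_trans (C1c_le_line KB cu i x) _.
  apply: ge0_le_integral => //.
  + apply/measurable_EFinP; apply: measurableT_comp => //.
    exact: (measurableT_comp (measurable_C1c' i cu) (measurable_upd i x)).
  + apply/measurable_EFinP.
    exact: (measurableT_comp mG (measurable_upd i x)).
  + by move=> s _; rewrite lee_fin.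
Qed.

End C1_integrals.

(** * Derivatives of powers of the absolute value *)

Section power_norm.
Context {R : realType}.

Lemma is_derive_normX3 (s : R) :
  is_derive s (1 : R) (fun t => `|t| ^+ 3) (3 * (`|s| * s)).
Proof.
have d3 : is_derive s (1 : R) (fun t : R => t ^+ 3) (3 * s ^+ 2).
  have := @is_deriveX R R id 3 s 1 1 (is_derive_id _ _).
  by rewrite /GRing.scale/= mulr1.
have [s0|s0|->] := ltgtP s 0.
- have := is_deriveN d3; rewrite ltr0_norm// (_ : - (3 * s ^+ 2) = 3 * (- s * s)); last by ring.
  apply: near_eq_is_derive; near=> t; rewrite /= fctE.
  have t0 : t < 0 by near: t; exact: lt_nbhsl.
  by rewrite ltr0_norm//; ring.
- have := d3; rewrite gtr0_norm// (_ : 3 * s ^+ 2 = 3 * (s * s)); last by ring.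
  apply: near_eq_is_derive; near=> t.
  have t0 : 0 < t by near: t; exact: lt_nbhsr.
  by rewrite gtr0_norm.
- rewrite !mulr0.
  (* At 0 the difference quotient is [h * |h|]; both sides are 0 at [h = 0], so the functions agree
     everywhere. *)
  have c0 : (fun h : R => h^-1 *: ((((fun t : R => `|t| ^+ 3) \o shift (0 : R)) (h *: (1 : R))
      - `|0 : R| ^+ 3) : R)) @ (0 : R)^' --> (0 : R).
    rewrite (_ : (fun h => _) = fun h : R => h * `|h|); last first.
      apply/funext => h; rewrite /= normr0 expr0n subr0 addr0 /GRing.scale/= mulr1.
      have [->|h0] := eqVneq h 0; first by rewrite invr0 !mul0r.
      rewrite exprS real_normK ?num_real//; by field.
    apply: cvg_within_filter.
    have : (fun h : R => h * `|h|) @ (0 : R) --> (0 : R) * `|0 : R|.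
      by apply: cvgM; [exact: cvg_id|apply: cvg_norm; exact: cvg_id].
    by rewrite mul0r.
  apply: DeriveDef; first by apply/cvg_ex; exists 0.
  exact/cvg_lim.
Unshelve. all: by end_near. Qed.

(** Induction in steps of two: multiplying by [|t| ^+ 2 = t ^+ 2] raises the exponent by 2, so the
    exponents 2 and 3 are the base cases. *)
Lemma is_derive_normX n (s : R) :
  is_derive s (1 : R) (fun t => `|t| ^+ n.+2) (n.+2%:R * (`|s| ^+ n * s)).
Proof.
have d2 : is_derive s (1 : R) (fun t : R => t ^+ 2) (2 * s).
  have := @is_deriveX R R id 2 s 1 1 (is_derive_id _ _).
  by rewrite /GRing.scale/= mulr1 expr1.
elim/ltn_ind: n => -[_|[_|n IH]].
- rewrite (_ : (fun t => _) = (fun t : R => t ^+ 2)) ?mul1r//.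
  by apply/funext => t; rewrite real_normK// num_real.
- by rewrite expr1; exact: is_derive_normX3.
- rewrite (_ : (fun t => _) = (fun t : R => t ^+ 2) * (fun t => `|t| ^+ n.+2)).
    apply: (is_derive_eq (is_deriveM d2 (IH n _))) => //.
    rewrite /GRing.scale/= !exprS.
    have ss : `|s| * `|s| = s * s by rewrite -!expr2 real_normK// num_real.
    rewrite [`|s| * (_ * _)]mulrA ss -(natr1 n.+3) -(natr1 n.+2).    ring.
  by apply/funext => t; rewrite fctE/= -(real_normK (num_real t)) -exprD.
Qed.

End power_norm.

(** * The Hardy inequality and its higher-exponent analogues *)

(** Inversion is discontinuous at 0; written as x times |x|^-2, with both sides 0 at 0, it reduces
    to a real power. *)
Lemma measurable_inv (R : realType) :
  measurable_fun [set: R] (fun x : R => x^-1).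
Proof.
rewrite (_ : (fun x : R => x^-1) = fun x : R => x * `|x| `^ (- 2%:R)).
  apply: measurable_funM => //.
  exact: (measurableT_comp (measurable_powR _)).
apply/funext => x; rewrite powR_invn// real_normK ?num_real//.
by have [->|x0] := eqVneq x 0; [rewrite invr0 mul0r|field].
Qed.

Lemma measurable_e (R : realType) n : measurable_fun [set: 'rV[R]_n] (@e_ R n).
Proof.
apply: (@measurableT_comp _ _ _ _ _ _ (fun t : R => t^-1)).
  exact: measurable_inv.
apply: measurable_funB => //; apply: measurable_sum => i.
by apply: measurable_funX; exact: measurable_coord.
Qed.

Section ge0_int.
Local Open Scope ereal_scope.
Context d (T : measurableType d) (R : realType) (mu : {measure set T -> \bar R}).
Implicit Types f g : T -> R.

Lemma ge0_intD f g : measurable_fun setT f -> measurable_fun setT g ->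
  (forall x, 0 <= f x)%R -> (forall x, 0 <= g x)%R ->
  \int[mu]_x (f x + g x)%:E = \int[mu]_x (f x)%:E + \int[mu]_x (g x)%:E.
Proof.
move=> mf mg f0 g0.
rewrite -(@ge0_integralD _ _ _ mu setT measurableT (EFin \o f) (EFin \o g))//.
- by move=> x _; rewrite lee_fin.
- exact/measurable_EFinP.
- by move=> x _; rewrite lee_fin.
- exact/measurable_EFinP.
Qed.

Lemma ge0_intZ (c : R) f : (0 <= c)%R -> measurable_fun setT f ->
  (forall x, 0 <= f x)%R ->
  \int[mu]_x (c * f x)%:E = c%:E * \int[mu]_x (f x)%:E.
Proof.
move=> c0 mf f0.
rewrite -(@ge0_integralZl_EFin _ _ _ mu setT measurableT (EFin \o f))//.
- by move=> x _; rewrite lee_fin.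
- exact/measurable_EFinP.
Qed.

Lemma ge0_int_sum (I : finType) (F : I -> T -> R) :
  (forall i, measurable_fun setT (F i)) -> (forall i x, 0 <= F i x)%R ->
  \int[mu]_x (\sum_i F i x)%:E = \sum_i \int[mu]_x (F i x)%:E.
Proof.
move=> mF F0; rewrite -ge0_integral_sum//.
- by apply: eq_integral => x _; rewrite sumEFin.
- by move=> i; exact/measurable_EFinP.
- by move=> i x _; rewrite lee_fin.
Qed.

Lemma ge0_int_le f g : measurable_fun setT f -> measurable_fun setT g ->
  (forall x, 0 <= f x)%R -> (forall x, f x <= g x)%R ->
  \int[mu]_x (f x)%:E <= \int[mu]_x (g x)%:E.
Proof.
move=> mf mg f0 fg; apply: ge0_le_integral => //.
- by move=> x _; rewrite lee_fin.
- exact/measurable_EFinP.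
- exact/measurable_EFinP.
- by move=> x _; rewrite lee_fin.
Qed.

End ge0_int.

Section hardy.
Context {R : realType} {n : nat}.
Local Notation L := (@lebesgue_rV R n.+2).
Local Notation N := n.+2.

(** The l^1 norm of the Euclidean gradient. It dominates every partial derivative and costs only a
    constant depending on the dimension. *)
Definition grad1 (f' : 'I_N -> 'rV[R]_N -> R) x : R := \sum_i `|f' i x|.

(** The quantity A_s of the overview. *)
Definition wint (f : 'rV[R]_N -> R) (s : R) : \bar R :=
  (\int[L]_x (`|f x| `^ s * `|e_ x| ^+ N)%:E)%E.

(** Distinguish whether [a * 2 <= b]. The coefficient 1/2 is what allows the power of [b] to be
    absorbed in the Hardy inequality. *)
Lemma young_half (a b : R) k : 0 <= a -> 0 <= b ->
  b ^+ k * a <= b ^+ k.+1 / 2 + 2 ^+ k * a ^+ k.+1.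
Proof.
move=> a0 b0; have [ab|ab] := leP (a * 2) b.
  apply: (@le_trans _ _ (b ^+ k * (b / 2))).
    by rewrite ler_wpM2l ?exprn_ge0// ler_pdivlMr.
  by rewrite mulrA -exprSr lerDl mulr_ge0// exprn_ge0.
apply: (@le_trans _ _ ((a * 2) ^+ k * a)).
  by rewrite ler_wpM2r// lerXn2r// ?nnegrE ?mulr_ge0// ltW.
by rewrite exprMn mulrAC -exprSr mulrC lerDr divr_ge0// exprn_ge0.
Qed.

Section C1.
Context (K : set 'rV[R]_N) (f : 'rV[R]_N -> R) (f' : 'I_N -> 'rV[R]_N -> R).
Hypotheses (cK : compact K) (KB : K `<=` hball) (cf : C1c K f f').

Let ge0_e x : K x -> `|e_ x| = e_ x.
Proof. by move=> /KB/e_gt0 e0; rewrite gtr0_norm. Qed.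

Lemma measurable_grad1 : measurable_fun [set: 'rV[R]_N] (grad1 f').
Proof.
apply: measurable_sum => i; apply: measurableT_comp => //.
exact: measurable_C1c' cf.
Qed.

Lemma grad1_ge0 x : 0 <= grad1 f' x.
Proof. exact: sumr_ge0. Qed.

(* [w x *: x] is [`|f| ^+ N] times the vector field [X = e_ ^+ N.-1 *: x], for
   which [div X >= N * e_ ^+ N] in the ball; [z' i] is the [i]-th term of the
   divergence of the product. *)
Let w x := `|f x| ^+ N * e_ x ^+ n.+1.
Let w' i x := N%:R * (`|f x| ^+ n * f x) * f' i x * e_ x ^+ n.+1 +
  `|f x| ^+ N * e_X' n.+1 i x.

Let cw : C1c K w w'.
Proof.
have := C1c_comp cf (@is_derive_normX R n).
move=> /(_ _ _)/(C1c_mul cK KB); apply.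
- move=> s; apply: (@continuousM R R (cst N%:R) (fun s : R => `|s| ^+ n * s)).
    exact: cst_continuous.
  apply: (@continuousM R R (fun s : R => `|s| ^+ n) id) => //.
  apply: (@continuous_comp _ _ _ (fun s : R => `|s|) (fun t => t ^+ n)).
    exact: norm_continuous.
  exact: exprn_continuous.
- by rewrite normr0 expr0n.
- exact: continuous_eX.
- exact: continuous_eX'.
- exact: is_derive_eX.
Qed.

Let z' i x := w' i x * x ord0 i + w x.

Let cz i : C1c K (fun x => w x * x ord0 i) (fun j x => w' j x * x ord0 i + w x * (i == j)%:R).
Proof.
apply: (C1c_mul cK KB cw).
- by move=> x _; exact: coord_continuous.
- by move=> j x _; exact: cst_continuous.
- by move=> j x s _; exact: is_derive_coord.
Qed.

(* The divergence is split into positive and negative parts so that its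
   vanishing integral can be used with nonnegative integrals only. *)
Lemma hardy_pointwise x : `|f x| ^+ N * `|e_ x| ^+ N +
    2 / N%:R * \sum_i Num.max (- z' i x) 0 <=
  2 / N%:R * \sum_i Num.max (z' i x) 0 + 2 ^+ N * grad1 f' x ^+ N.
Proof.
have maxE (a : R) : Num.max a 0 = a + Num.max (- a) 0.
  by rewrite !maxEle; case: (leP a 0); case: (leP (- a) 0) => *; lra.
under [in leRHS]eq_bigr do rewrite maxE.
rewrite big_split/= mulrDr addrAC lerD2r.
have [Kx|Kx] := pselect (K x); last first.
  rewrite (C1c_supp cf)// normr0 expr0n mul0r addr_ge0//.
    rewrite big1 ?mulr0// => i _; rewrite /z' /w (C1c_supp' cK cw)//.
    by rewrite (C1c_supp cf)// normr0 expr0n !mul0r addr0.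
  by rewrite mulr_ge0 ?exprn_ge0// grad1_ge0.
have e0 := e_gt0 (KB Kx); rewrite ge0_e//.
set F := `|f x|; set e := e_ x; set r := \sum_j x ord0 j ^+ 2.
have r1 : r < 1 by apply/hballE; exact: KB.
have r0 : 0 <= r := normsq_ge0 x.
have er : e * (1 - r) = 1 by rewrite mulVf// subr_eq0 gt_eqF.
have N0 : N%:R != 0 :> R by rewrite pnatr_eq0.
have F0 : 0 <= F by exact: normr_ge0.
(* With r = |x|^2 and e^(N-1) = e^N (1 - r), the divergence of X is e^N (2 (N-1) r + N (1 - r)) =
   e^N (N + n r). *)
have sumz : \sum_i z' i x = N%:R * (F ^+ n * f x * e ^+ n.+1) *
    (\sum_i f' i x * x ord0 i) + F ^+ N * e ^+ N * (N%:R + n%:R * r).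
  transitivity (\sum_i (N%:R * (F ^+ n * f x * e ^+ n.+1) * (f' i x * x ord0 i) +
      F ^+ N * e ^+ N * (2 * n.+1)%:R * x ord0 i ^+ 2 + F ^+ N * e ^+ n.+1)).
    apply: eq_bigr => i _; rewrite /z' /w' /w /e_X' -/F -/e.
    by rewrite !exprS expr0; ring.
  rewrite !big_split/= -!mulr_sumr -/r sumr_const card_ord -[e ^+ n.+1 *+ N]mulr_natl.
  rewrite -addrA; congr (_ + _).
  have -> : F ^+ N * (N%:R * e ^+ n.+1) = N%:R * (F ^+ N * e ^+ N * (1 - r)).
    have -> : e ^+ n.+1 = e ^+ N * (1 - r).
      by rewrite (exprSr e n.+1) -mulrA er mulr1.
    by move: (e ^+ N) (F ^+ N) (N%:R : R) => E E' N'; ring.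
  rewrite natrM -(natr1 n.+1) -(natr1 n); ring.
have sumge : - (F * grad1 f' x) <= f x * (\sum_i f' i x * x ord0 i).
  rewrite lerNl -mulrN; apply: le_trans (ler_norm _) _.
  rewrite normrM normrN ler_wpM2l//; apply: le_trans (ler_norm_sum _ _ _) _.
  apply: ler_sum => i _; rewrite normrM ler_piMr// ltW//.
  by apply: hball_coord; exact: KB.
(* Multiplied by 2, this bounds the cross term by one copy of (F e)^N plus the gradient term. The
   factor [2 / N%:R] in the statement makes the divergence supply two copies (see [Q]), so one is
   left over. *)
have Y := young_half n.+1 (grad1_ge0 x) (mulr_ge0 F0 (ltW e0)).
have P0 : 0 <= F ^+ n * e ^+ n.+1 by rewrite mulr_ge0 ?exprn_ge0// ltW.
have Z : - (2 * ((F * e) ^+ n.+1 * grad1 f' x)) <=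
    2 * (F ^+ n * e ^+ n.+1 * (f x * (\sum_i f' i x * x ord0 i))).
  rewrite -mulrN ler_pM2l// (_ : - _ = F ^+ n * e ^+ n.+1 * - (F * grad1 f' x)); last first.
    by rewrite exprMn (exprS F); ring.
  exact: ler_wpM2l.
rewrite sumz mulrDr (_ : 2 / N%:R * (_ * _ * _) =
  2 * (F ^+ n * e ^+ n.+1 * (f x * (\sum_i f' i x * x ord0 i)))); last by field.
have Q0 : 0 <= F ^+ N * e ^+ N by rewrite mulr_ge0 ?exprn_ge0// ltW.
have Q : 2 * (F ^+ N * e ^+ N) <= 2 / N%:R * (F ^+ N * e ^+ N * (N%:R + n%:R * r)).
  rewrite (_ : 2 / N%:R * _ =
    2 * (F ^+ N * e ^+ N) + 2 / N%:R * (F ^+ N * e ^+ N * (n%:R * r))); last by field.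
  by rewrite lerDl mulr_ge0 ?divr_ge0// mulr_ge0// mulr_ge0.
move: Z Q Y; rewrite !exprMn (exprS (2 : R) n.+1).
move: (2 ^+ n.+1 : R) (F ^+ N) (e ^+ N) (F ^+ n.+1) (e ^+ n.+1) (grad1 f' x ^+ N).
move=> a b c d a' b' Z Q Y; apply: le_trans (lerD (lerD Z Q) (lexx _)).
move: Y; rewrite -(mulrA 2 a); move: (d * a' * _ : R) (b * c : R) (a * b' : R) => y bc t; lra.
Qed.


Let c1z i : (forall x, ~ K x -> z' i x = 0) /\ continuous (z' i).
Proof.
rewrite (_ : z' i = fun x => w' i x * x ord0 i + w x * (i == i)%:R); last first.
  by apply/funext => x; rewrite eqxx mulr1.
split; first exact: (C1c_supp' cK (cz i) i).
exact: (@C1c_continuous' _ _ _ _ _ (cz i) i).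
Qed.

Let z'_posneg i :
  (\int[L]_x (Num.max (z' i x) 0)%:E = \int[L]_x (Num.max (- z' i x) 0)%:E)%E.
Proof.
have := C1c_integral_posneg cK KB (cz i) i; congr (_ = _);
  by apply: eq_integral => x _; rewrite eqxx mulr1.
Qed.

Let z'_fin i : (\int[L]_x (Num.max (- z' i x) 0)%:E < +oo)%E.
Proof.
have [z0 zc] := c1z i.
apply: le_lt_trans (integral_lt_supp cK KB zc z0).
have mz : measurable_fun [set: 'rV[R]_N] (z' i) by exact: continuous_measurable_rV.
apply: ge0_le_integral => //.
- by move=> x _; rewrite lee_fin le_max lexx orbT.
- apply/measurable_EFinP; apply: measurable_maxr => //.
  exact: measurableT_comp.
- by apply/measurable_EFinP; exact: measurableT_comp.
- by move=> x _; rewrite lee_fin ge_max normr_ge0 andbT -normrN ler_norm.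
Qed.

(** On integrating [hardy_pointwise], the positive and negative parts of the divergence have equal
    integrals; these are finite by compact support, so they cancel. *)
Lemma hardy : (wint f N%:R <= (2 ^+ N)%:E * \int[L]_x (grad1 f' x ^+ N)%:E)%E.
Proof.
have mz i : measurable_fun [set: 'rV[R]_N] (z' i).
  by have [_ zc] := c1z i; exact: continuous_measurable_rV.
have mp i : measurable_fun [set: 'rV[R]_N] (fun x => Num.max (z' i x) 0).
  exact: measurable_maxr.
have mn i : measurable_fun [set: 'rV[R]_N] (fun x => Num.max (- z' i x) 0).
  by apply: measurable_maxr => //; exact: measurableT_comp.
have max0 (a : R) : 0 <= Num.max a 0 by rewrite le_max lexx orbT.
pose c : R := 2 / N%:R; have c0 : 0 <= c by rewrite divr_ge0.
have sumE (F : 'I_N -> 'rV[R]_N -> R) :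
    (forall i, measurable_fun [set: 'rV[R]_N] (F i)) -> (forall i x, 0 <= F i x) ->
    (\int[L]_x (c * \sum_i F i x)%:E = c%:E * \sum_i \int[L]_x (F i x)%:E)%E.
  move=> mF F0; rewrite ge0_intZ ?ge0_int_sum//.
    exact: measurable_sum.
  by move=> x; exact: sumr_ge0.
have mg := measurable_grad1.
set S := (c%:E * \sum_i \int[L]_x (Num.max (- z' i x) 0)%:E)%E.
have Sfin : S \is a fin_num.
  rewrite fin_numM// ge0_fin_numE; last first.
    by apply: sume_ge0 => i _; apply: integral_ge0 => x _; rewrite lee_fin.
  by apply: lte_sum_pinfty => i _; exact: z'_fin.
have mfe : measurable_fun [set: 'rV[R]_N] (fun x => `|f x| `^ N%:R * `|e_ x| ^+ N).
  apply: measurable_funM.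
    apply: (measurableT_comp (measurable_powR _)); apply: measurableT_comp => //.
    exact: measurable_C1c cf.
  by apply: measurable_funX; apply: measurableT_comp => //; exact: measurable_e.
have msum (F : 'I_N -> 'rV[R]_N -> R) :
    (forall i, measurable_fun [set: 'rV[R]_N] (F i)) ->
    measurable_fun [set: 'rV[R]_N] (fun x => c * \sum_i F i x).
  by move=> mF; apply: measurable_funM => //; exact: measurable_sum.
have msn : measurable_fun [set: 'rV[R]_N] (fun x => c * \sum_i Num.max (- z' i x) 0).
  exact: msum.
have msp : measurable_fun [set: 'rV[R]_N] (fun x => c * \sum_i Num.max (z' i x) 0).
  exact: msum.
have mfg : measurable_fun [set: 'rV[R]_N] (fun x => 2 ^+ N * grad1 f' x ^+ N).
  by apply: measurable_funM => //; exact: measurable_funX.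
have fe0 x : 0 <= `|f x| `^ N%:R * `|e_ x| ^+ N by rewrite mulr_ge0 ?powR_ge0// exprn_ge0.
have fg0 x : 0 <= 2 ^+ N * grad1 f' x ^+ N.
  by rewrite mulr_ge0 ?exprn_ge0// grad1_ge0.
have cs0 (F : 'I_N -> 'rV[R]_N -> R) x : 0 <= c * \sum_i Num.max (F i x) 0.
  by rewrite mulr_ge0// sumr_ge0.
rewrite -(@leeD2rE _ S)// {1}/S -sumE// /wint -ge0_intD//.
rewrite /S; under eq_bigr do rewrite -z'_posneg.
rewrite -sumE// -ge0_intZ//.
- rewrite -ge0_intD//; apply: ge0_int_le => //.
  + exact: measurable_funD.
  + exact: measurable_funD.
  + move=> x; exact: (addr_ge0 (fe0 x) (cs0 (fun i x => - z' i x) x)).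
  + by move=> x; rewrite powR_mulrn// [leRHS]addrC; exact: hardy_pointwise.
- exact: measurable_funX.
- by move=> x; rewrite exprn_ge0// grad1_ge0.
- by move=> x; exact: (cs0 (fun i x => - z' i x)).
Qed.

End C1.
End hardy.

(** * Iteration on the exponent *)

Section moser.
Context {R : realType} {n : nat}.
Local Notation L := (@lebesgue_rV R n.+2).
Local Notation N := n.+2.
Let p : R := 1 + n.+1%:R^-1.

Let p_gt0 : 0 < p. Proof. by rewrite addr_gt0// invr_gt0 ltr0n. Qed.

(** The identity that closes the iteration: the weight [e_ ^+ n.+1] raised to the power [p] is the
    volume weight [e_ ^+ N]. *)
Let pS : n.+1%:R * p = N%:R.
Proof. by rewrite mulrDr mulr1 mulfV ?pnatr_eq0// natr1. Qed.

Lemma young_sum (a b : R) : 0 <= a -> 0 <= b -> a * b <= a `^ p + b ^+ N.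
Proof.
move=> a0 b0; have N0 : 0 < N%:R :> R by rewrite ltr0n.
have pN : p^-1 + N%:R^-1 = 1.
  have n0 : n.+1%:R != 0 :> R by rewrite pnatr_eq0.
  have N1 : n.+1%:R + 1 != 0 :> R by rewrite natr1 pnatr_eq0.
  rewrite /p -(natr1 n.+1); move: n0 N1; move: (n.+1%:R : R) => x x0 x1.
  by field; rewrite x0 x1.
have := conjugate_powR a0 b0 p_gt0 N0 pN.
move=> /le_trans; apply; rewrite powR_mulrn// lerD//.
  rewrite ler_pdivrMr// ler_peMr ?powR_ge0// lerDl invr_ge0//.
by rewrite ler_pdivrMr// ler_peMr ?exprn_ge0// ler1n.
Qed.

Lemma powR_between (t a b s : R) : 0 <= t -> 0 < a -> a <= s -> s <= b ->
  t `^ s <= t `^ a + t `^ b.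
Proof.
move=> t0 a0 as_ sb; have [t1|t1] := leP t 1.
  apply: (@le_trans _ _ (t `^ a)); last by rewrite lerDl powR_ge0.
  move: t0; rewrite le_eqVlt => /predU1P[<-|t0].
    by rewrite !powR0// gt_eqF// (lt_le_trans a0).
  by apply: ger_powR => //; rewrite t0.
apply: (@le_trans _ _ (t `^ b)); last by rewrite lerDr powR_ge0.
by apply: ler_powR => //; exact: ltW.
Qed.

Section C1.
Context (K : set 'rV[R]_N) (f : 'rV[R]_N -> R) (f' : 'I_N -> 'rV[R]_N -> R).
Hypotheses (cK : compact K) (KB : K `<=` hball) (cf : C1c K f f').

Let ge0_wint s x : 0 <= `|f x| `^ s * `|e_ x| ^+ N.
Proof. by rewrite mulr_ge0 ?powR_ge0// exprn_ge0. Qed.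

Let mf : measurable_fun [set: 'rV[R]_N] f. Proof. exact: measurable_C1c cf. Qed.

Let mnf : measurable_fun [set: 'rV[R]_N] (fun x => `|f x|).
Proof. exact: measurableT_comp. Qed.

Let mne : measurable_fun [set: 'rV[R]_N] (fun x => `|e_ x|).
Proof. by apply: measurableT_comp => //; exact: measurable_e. Qed.

Lemma measurable_wint s :
  measurable_fun [set: 'rV[R]_N] (fun x => `|f x| `^ s * `|e_ x| ^+ N).
Proof.
apply: measurable_funM; last exact: measurable_funX.
exact: (measurableT_comp (measurable_powR _)).
Qed.

Lemma wint_between a b s : 0 < a -> a <= s -> s <= b ->
  (wint f s <= wint f a + wint f b)%E.
Proof.
move=> a0 as_ sb; rewrite /wint -ge0_intD//; first last.
- exact: measurable_wint.
- exact: measurable_wint.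
apply: ge0_int_le => //.
- exact: measurable_wint.
- by apply: measurable_funD; exact: measurable_wint.
- by move=> x; rewrite -mulrDl ler_wpM2r ?exprn_ge0//; exact: powR_between.
Qed.

Let mg := measurable_grad1 cf.

(* Gagliardo-Nirenberg for [f ^+ m.+2 * e_ ^+ N.-1]. *)
Lemma wint_step m :
  (wint f (m.+2%:R * p) <=
   (m.+2%:R%:E * (wint f (m.+1%:R * p) + \int[L]_x (grad1 f' x ^+ N)%:E) +
    (2 * n.+1)%:R%:E * wint f m.+2%:R) `^ p)%E.
Proof.
pose u x := f x ^+ m.+2 * e_ x ^+ n.+1.
pose u' i x := m.+2%:R * f x ^+ m.+1 * f' i x * e_ x ^+ n.+1 +
  f x ^+ m.+2 * e_X' n.+1 i x.
have cu : C1c K u u'.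
  have := @C1c_comp _ _ _ _ _ (fun t => t ^+ m.+2)
    (fun t => m.+2%:R * t ^+ m.+1) cf.
  move=> /(_ _ _ _)/(C1c_mul cK KB); apply.
  - move=> s; rewrite (_ : (fun t => _) = (@id R) ^+ m.+2); last first.
      by apply/funext => t; rewrite fctE.
    have := @is_deriveX R R id m.+2 s 1 1 (is_derive_id _ _).
    by rewrite /GRing.scale/= mulr1.
  - move=> s; apply: (@continuousM R R (cst m.+2%:R) (fun s : R => s ^+ m.+1)).
      exact: cst_continuous.
    exact: exprn_continuous.
  - by rewrite expr0n.
  - exact: continuous_eX.
  - exact: continuous_eX'.
  - exact: is_derive_eX.
(* A common majorant of all the partial derivatives of [u]; in the second term the coordinate of [x]
   is bounded by 1, as the support lies in the ball. *)
pose G x := m.+2%:R * (`|f x| ^+ m.+1 * `|e_ x| ^+ n.+1 * grad1 f' x) +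
  (2 * n.+1)%:R * (`|f x| `^ m.+2%:R * `|e_ x| ^+ N).
have mG : measurable_fun [set: 'rV[R]_N] G.
  apply: measurable_funD; apply: measurable_funM => //.
    apply: measurable_funM => //; apply: measurable_funM => //; exact: measurable_funX.
  exact: measurable_wint.
have G0 x : 0 <= G x.
  apply: addr_ge0; apply: mulr_ge0 => //.
  by rewrite mulr_ge0 ?grad1_ge0// mulr_ge0// exprn_ge0.
have uG i x : `|u' i x| <= G x.
  have [Kx|Kx] := pselect (K x); last by rewrite (C1c_supp' cK cu)// normr0.
  rewrite /u' /e_X'. apply: le_trans (ler_normD _ _) _; rewrite !normrM !normrX !normr_nat lerD//.
    rewrite -!mulrA ler_wpM2l// ler_wpM2l ?exprn_ge0// mulrC ler_wpM2l ?exprn_ge0//.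
    by rewrite /grad1 (bigD1 i)//= lerDl sumr_ge0.
  rewrite powR_mulrn// (_ : _ * (_ * _ * _) = (2 * n.+1)%:R *
    (`|f x| ^+ m.+2 * (`|x ord0 i| * `|e_ x| ^+ N))); last by rewrite -mulrA mulrCA.
  rewrite ler_wpM2l//.
  rewrite ler_wpM2l ?exprn_ge0// ler_piMl ?exprn_ge0//.
  by rewrite ltW//; apply: hball_coord; exact: KB.
have := C1c_gagliardo_nirenberg cK KB cu mG uG.
rewrite -/p => gn.
have -> : wint f (m.+2%:R * p) = (\int[L]_x (`|u x| `^ p)%:E)%E.
  apply: eq_integral => x _; rewrite /u normrM !normrX powRM ?exprn_ge0//.
  by rewrite -!powR_mulrn// -!powRrM pS.
apply: le_trans gn _; apply: gt0_ler_poweR; first exact: ltW.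
- rewrite in_itv/= leey andbT; apply: integral_ge0 => x _.
  by rewrite lee_fin (le_trans _ (uG ord0 x)).
- rewrite in_itv/= leey andbT; apply: adde_ge0; apply: mule_ge0 => //.
    apply: adde_ge0; apply: integral_ge0 => x _; rewrite lee_fin//.
    by rewrite exprn_ge0// grad1_ge0.
  by apply: integral_ge0 => x _; rewrite lee_fin.
have mgN : measurable_fun [set: 'rV[R]_N] (fun x => grad1 f' x ^+ N).
  exact: measurable_funX.
have g0 x : 0 <= grad1 f' x ^+ N by rewrite exprn_ge0// grad1_ge0.
have mw1 := measurable_wint (m.+1%:R * p).
have mw2 := measurable_wint m.+2%:R.
have wp1 := ge0_wint (m.+1%:R * p).
have wp2 := ge0_wint m.+2%:R.
(* What Young's inequality with exponents [p] and [N] makes of the first term of [G]. *)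
pose A x := `|f x| `^ (m.+1%:R * p) * `|e_ x| ^+ N + grad1 f' x ^+ N.
have mA : measurable_fun [set: 'rV[R]_N] A by exact: measurable_funD.
have A0 x : 0 <= A x by rewrite addr_ge0.
have mA' : measurable_fun [set: 'rV[R]_N] (fun x => m.+2%:R * A x).
  exact: measurable_funM.
have A0' x : 0 <= m.+2%:R * A x by rewrite mulr_ge0.
pose B x := (2 * n.+1)%:R * (`|f x| `^ m.+2%:R * `|e_ x| ^+ N).
have mB : measurable_fun [set: 'rV[R]_N] B by exact: measurable_funM.
have B0 x : 0 <= B x by rewrite mulr_ge0.
rewrite /wint -ge0_intD// -(ge0_intZ _ _ mA)// -(ge0_intZ _ _ mw2)//.
rewrite -(ge0_intD _ mA' mB)//.
apply: ge0_int_le => //; first exact: measurable_funD.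
- move=> x; rewrite lerD2r ler_wpM2l//.
  have ab0 : 0 <= `|f x| ^+ m.+1 * `|e_ x| ^+ n.+1 by rewrite mulr_ge0// exprn_ge0.
  apply: le_trans (young_sum ab0 (grad1_ge0 f' x)) _.
  rewrite lerD2r powRM ?exprn_ge0// -!powR_mulrn// -!powRrM pS//.
Qed.

End C1.

(** The starting exponent is [n.+1%:R * p = N], where the Hardy inequality applies. In [wint_step]
    the intermediate exponent [m.+2] lies between [N] and the preceding one, so its integral is
    bounded by the sum of those two. *)
Lemma wint_bounded_seq k : exists C : R, 0 <= C /\
  forall K f f', compact K -> K `<=` hball -> @C1c R N K f f' ->
  (\int[L]_x (grad1 f' x ^+ N)%:E <= 1)%E ->
  (wint f ((n.+1 + k)%:R * p) <= C%:E)%E.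
Proof.
elim: k => [|k [C [C0 IH]]].
  exists (2 ^+ N); split => [|K f f' cK KB cf D1]; first exact: exprn_ge0.
  rewrite addn0 pS; apply: le_trans (hardy cK KB cf) _.
  by rewrite -[leRHS]mule1 lee_wpmul2l// lee_fin exprn_ge0.
(* The right-hand side of [wint_step] with energy 1, the preceding integral replaced by [C] and the
   intermediate one by [2 ^+ N + C]. *)
pose C' := ((n + k).+2%:R * (C + 1) + (2 * n.+1)%:R * (2 ^+ N + C)) `^ p.
exists C'; split => [|K f f' cK KB cf D1]; first exact: powR_ge0.
have IHf := IH K f f' cK KB cf D1.
rewrite addnS addSn; apply: le_trans (wint_step cK KB cf (n + k)) _.
rewrite -poweR_EFin; apply: gt0_ler_poweR; first exact: ltW.
- have w0 s : (0 <= wint f s)%E.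
    by apply: integral_ge0 => x _; rewrite lee_fin mulr_ge0 ?powR_ge0// exprn_ge0.
  rewrite in_itv/= leey andbT; apply: adde_ge0; apply: mule_ge0 => //.
  apply: adde_ge0 => //; apply: integral_ge0 => x _; rewrite lee_fin.
  by rewrite exprn_ge0// grad1_ge0.
- rewrite in_itv/= leey andbT lee_fin; apply: addr_ge0; apply: mulr_ge0 => //;
    apply: addr_ge0 => //; exact: exprn_ge0.
rewrite [leRHS]EFinD (EFinM _ (C + 1)) (EFinM _ (2 ^+ N + C)).
apply: leeD; rewrite lee_wpmul2l//.
  by rewrite EFinD; exact: leeD.
have N0 : 0 < N%:R :> R by rewrite ltr0n.
have le1 : N%:R <= (n + k).+2%:R :> R by rewrite ler_nat !ltnS leq_addr.
have le2 : (n + k).+2%:R <= (n.+1 + k)%:R * p.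
  rewrite addSn /p mulrDr mulr1 -(natr1 (n + k).+1) lerD2l.
  by rewrite ler_pdivlMr ?mul1r ?ler_nat ?ltr0n// ltnS leq_addr.
apply: le_trans (wint_between cf N0 le1 le2) _.
rewrite EFinD; apply: leeD => //; apply: le_trans (hardy cK KB cf) _.
by rewrite -[leRHS]mule1 lee_wpmul2l// lee_fin exprn_ge0.
Qed.

Lemma wint_bounded (s : R) : N%:R <= s -> exists C : R, 0 <= C /\
  forall K f f', compact K -> K `<=` hball -> @C1c R N K f f' ->
  (\int[L]_x (grad1 f' x ^+ N)%:E <= 1)%E -> (wint f s <= C%:E)%E.
Proof.
move=> Ns; have [C [C0 CP]] := wint_bounded_seq (Num.truncn s).+1.
exists (2 ^+ N + C); split => [|K f f' cK KB cf D1].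
  by rewrite addr_ge0// exprn_ge0.
have N0 : 0 < N%:R :> R by rewrite ltr0n.
have sb : s <= (n.+1 + (Num.truncn s).+1)%:R * p.
  apply: (@le_trans _ _ (n.+1 + (Num.truncn s).+1)%:R).
    rewrite natrD (le_trans (ltW (truncnS_gt _)))// lerDr//.
  by rewrite ler_peMr// lerDl invr_ge0.
apply: le_trans (wint_between cf N0 Ns sb) _.
rewrite EFinD; apply: leeD; last exact: (CP K f f').
apply: le_trans (hardy cK KB cf) _.
by rewrite -[leRHS]mule1 lee_wpmul2l// lee_fin exprn_ge0.
Qed.

End moser.

(** * The weight at the origin and the hyperbolic volume *)

Section dyadic_weight.
Context {R : realType}.
Variable gamma : R.
Local Notation mu := (@lebesgue_measure R).

Definition dyadic_itv k : interval R := `[- (2^-1 ^+ k), 2^-1 ^+ k].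

(* Dominates [`|s| `^ (- gamma)] on ]0, 1[; a dyadic series rather than the
   power itself because [0 `^ (- gamma)] is the junk value [0], and because its
   integral is a geometric series. *)
Definition dyadic_weight (s : R) : \bar R :=
  (\sum_(0 <= k <oo) ((2 `^ gamma) ^+ k.+1 * \1_[set` dyadic_itv k] s)%:E)%E.

Let mterm k : measurable_fun [set: measurableTypeR R]
  (fun s => ((2 `^ gamma) ^+ k.+1 * \1_[set` dyadic_itv k] s)%:E).
Proof. by apply/measurable_EFinP; exact: measurable_funM. Qed.

Lemma dyadic_weight_ge0 s : (0 <= dyadic_weight s)%E.
Proof. by apply: nneseries_ge0 => k _ _; rewrite lee_fin. Qed.

Lemma measurable_dyadic_weight :
  measurable_fun [set: measurableTypeR R] dyadic_weight.
Proof. by apply: ge0_emeasurable_sum => // k s _ _; rewrite lee_fin. Qed.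

(** The k-th interval has length 2 * 2^-k, so the terms form a geometric series of ratio 2^(gamma -
    1). *)
Lemma integral_dyadic_weight_lty : gamma < 1 -> (\int[mu]_s dyadic_weight s < +oo)%E.
Proof.
move=> g1; rewrite integral_nneseries//.
pose z := 2 `^ gamma / 2; pose a : R := 2 `^ gamma * 2.
have z0 : 0 <= z by rewrite divr_ge0// powR_ge0.
have a0 : 0 <= a by rewrite mulr_ge0// powR_ge0.
have z1 : z < 1.
  rewrite ltr_pdivrMr// mul1r -[ltRHS]powRr1//.
  by rewrite /powR !gt_eqF// ltr_expR ltr_pM2r// ln_gt0// ltr1n.
have termE k : (\int[mu]_s ((2 `^ gamma) ^+ k.+1 * \1_[set` dyadic_itv k] s)%:E =
    (a * z ^+ k)%:E)%E.
  have mi : measurable_fun [set: measurableTypeR R]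
      (\1_[set` dyadic_itv k] : R -> R).
    by apply: measurable_indic; exact: measurable_itv.
  rewrite (ge0_intZ mu _ mi) ?exprn_ge0 ?powR_ge0//.
  rewrite integral_indic ?setIT//.
  have := @lebesgue_measure_itv R (dyadic_itv k).
  rewrite /= lte_fin gtrN ?exprn_gt0// -EFinD opprK => ->.
  rewrite -EFinM /a /z exprMn exprS; congr (_%:E); ring.
under eq_eseriesr do rewrite termE.
apply: (@le_lt_trans _ _ (a / (1 - z))%:E); last exact: ltry.
apply: lime_le.
  by apply: is_cvg_nneseries => k _ _; rewrite lee_fin mulr_ge0// exprn_ge0.
apply: nearW => m; rewrite sumEFin lee_fin -mulr_sumr ler_wpM2l//.
rewrite -[leRHS]mul1r ler_pdivlMr ?subr_gt0// big_mkord mulrC.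
have := subrX1 z m; rewrite -opprB => /eqP; rewrite eqr_oppLR -mulNr opprB => /eqP <-.
by rewrite gerBl exprn_ge0.
Qed.

(** One term suffices: for the least k with 2^-(k+1) < r one has r <= 2^-k, so [s] lies in the k-th
    interval. In the application [s] is a coordinate, possibly 0, of a point of norm [r], hence the
    bound in terms of [r]. *)
Lemma dyadic_weight_ge (r s : R) : 0 <= gamma -> 0 < r -> r < 1 -> `|s| <= r ->
  ((r `^ (- gamma))%:E <= dyadic_weight s)%E.
Proof.
move=> g0 r0 r1 sr.
have exk : exists k, 2^-1 ^+ k.+1 < r.
  have [k kr] : exists k : nat, r^-1 < k.+1%:R.
    by exists (Num.truncn r^-1); exact: truncnS_gt.
  exists k; rewrite exprVn invf_plt ?posrE// (lt_le_trans kr)//.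
  by rewrite -natrX ler_nat ltnW// ltn_expl.
case: (ex_minnP exk) => k kr kmin.
have rk : r <= 2^-1 ^+ k.
  case: k kr kmin => [|k] kr kmin; first by rewrite expr0 ltW.
  by rewrite leNgt; apply/negP => /kmin; rewrite ltnn.
have H : ((r `^ (- gamma))%:E <=
    ((2 `^ gamma) ^+ k.+1 * \1_[set` dyadic_itv k] s)%:E)%E.
  rewrite lee_fin indicE mem_set ?mulr1; last first.
    by rewrite /= in_itv/= -ler_norml (le_trans sr).
  have -> : r `^ (- gamma) = r^-1 `^ gamma.
    by rewrite -powR_inv1 ?ltW// -powRrM mulN1r.
  rewrite -powR_mulrn ?powR_ge0// powRAC powR_mulrn//.
  apply: ge0_ler_powR; rewrite ?nnegrE//.
  - by rewrite invr_ge0 ltW.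
  - by rewrite ltW// invf_plt ?posrE ?exprn_gt0// -exprVn.
apply: le_trans H _; rewrite /dyadic_weight.
apply: le_trans (nneseries_lim_ge k.+1 _); last by move=> *; rewrite lee_fin.
rewrite big_nat_recr//= leeDr//; apply: sume_ge0 => *.
by rewrite lee_fin.
Qed.

End dyadic_weight.

(** * Integration against the hyperbolic volume *)

Section density.
Local Open Scope ereal_scope.
Context d (T : measurableType d) (R : realType).
Variables mu nu : {measure set T -> \bar R}.
Variable D : T -> R.
Hypotheses (mD : measurable_fun [set: T] D) (D0 : forall x, (0 <= D x)%R).
Hypothesis nuE : forall A, measurable A -> nu A = \int[mu]_(x in A) (D x)%:E.

Import HBNNSimple.

Let mDE : measurable_fun [set: T] (EFin \o D). Proof. exact/measurable_EFinP. Qed.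

(** The density is known on sets only; it passes to simple functions by linearity and to [h] by
    monotone convergence under both measures. *)
Lemma ge0_integral_density (h : T -> \bar R) : measurable_fun [set: T] h ->
  (forall x, 0 <= h x) ->
  \int[nu]_x h x = \int[mu]_x (h x * (D x)%:E).
Proof.
move=> mh h0; pose h_ := nnsfun_approx measurableT mh.
transitivity (limn (fun n => \int[nu]_x (h_ n x)%:E)).
  rewrite -monotone_convergence//.
  - apply: eq_integral => y _; apply/esym/cvg_lim => //.
    exact: cvg_nnsfun_approx.
  - by move=> n; exact/measurable_EFinP/measurable_funP.
  - by move=> n y _; rewrite lee_fin.
  - by move=> y _ m n mn; rewrite lee_fin; exact/lefP/nd_nnsfun_approx.
rewrite [X in limn X](_ : _ = (fun n => \int[mu]_x ((h_ n x)%:E * (D x)%:E))).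
  rewrite -monotone_convergence//.
  - apply: eq_integral => y _; apply/cvg_lim => //.
    apply: cvgeZr => //; exact: cvg_nnsfun_approx.
  - move=> n; apply: emeasurable_funM => //.
    exact/measurable_EFinP/measurable_funP.
  - by move=> n y _; rewrite mule_ge0// lee_fin.
  - move=> y _ m n mn; rewrite lee_wpmul2r// lee_fin//.
    exact/lefP/nd_nnsfun_approx.
apply/funext => n; rewrite integralT_nnsfun sintegralE.
have F0 r x : (0 <= r * \1_(h_ n @^-1` [set r]) x * D x)%R.
  by rewrite mulr_ge0//; have := nnfun_muleindic_ge0 (h_ n) r x; rewrite lee_fin.
have mF r : measurable_fun [set: T] (fun x => r * \1_(h_ n @^-1` [set r]) x * D x)%R.
  by apply: measurable_funM => //; exact: measurable_funM.
transitivity (\int[mu]_x (\sum_(r \in range (h_ n))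
    (r * \1_(h_ n @^-1` [set r]) x * D x)%:E)); last first.
  apply: eq_integral => x _; rewrite [in RHS]fimfunE -EFinM.
  rewrite fsumEFin//; congr (_%:E).
  by rewrite !fsbig_finite//= mulr_suml.
rewrite ge0_integral_fsum//; last 2 first.
- by move=> r; exact/measurable_EFinP.
- by move=> r x _; rewrite lee_fin.
apply: eq_fsbigr => r /set_mem [x _ <-].
set A := _ @^-1` _.
have mA : measurable A by exact: measurable_sfunP.
rewrite nuE// integral_mkcond -ge0_integralZl//; last 3 first.
- by apply/(measurable_restrictT _ _).1 => //; exact: measurable_funTS.
- by move=> y _; rewrite patchE; case: ifP => // _; rewrite lee_fin.
- by rewrite lee_fin.
apply: eq_integral => y _; rewrite patchE indicE; case: ifPn => yA.
  by rewrite mulr1 EFinM.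
by rewrite mulr0 mul0r mule0.
Qed.

End density.

Section hyperbolic_integral.
Context {R : realType} {n : nat}.
Implicit Types x : 'rV[R]_n.
Local Notation L := (@lebesgue_rV R n).

(** [hdensity] cut off outside the ball, so that hyperbolic integrals become integrals over all of
    R^n. *)
Definition hdens x : R := 2 ^+ n * e_ x ^+ n * \1_hball x.

Lemma hdens_ge0 x : 0 <= hdens x.
Proof.
rewrite /hdens indicE; have [xB|_] := boolP (x \in hball); last by rewrite mulr0.
by rewrite mulr1 mulr_ge0 ?exprn_ge0// ltW// e_gt0//; exact: set_mem.
Qed.

Lemma measurable_hdens : measurable_fun [set: 'rV[R]_n] hdens.
Proof.
apply: measurable_funM.
  by apply: measurable_funM => //; apply: measurable_funX; exact: measurable_e.
by apply: measurable_indic; exact: measurable_hball.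
Qed.

Lemma integral_hvol (h : 'rV[R]_n -> \bar R) :
  measurable_fun [set: 'rV[R]_n] h -> (forall x, 0 <= h x)%E ->
  (\int[hvol]_x h x = \int[L]_x (h x * (hdens x)%:E))%E.
Proof.
move=> mh h0.
apply: (@ge0_integral_density _ _ R L hvol hdens) => //.
- exact: measurable_hdens.
- exact: hdens_ge0.
- move=> A mA; rewrite [LHS](_ : _ =
      \int[L]_(x in A `&` hball) (hdensity x)%:E)%E// integral_mkcondr.
  apply: eq_integral => x _.
  rewrite patchE /hdens indicE; case: ifPn => xB; last by rewrite mulr0.
  by rewrite mulr1 /hdensity enorm_sq /e_ exprVn.
Qed.

Lemma measurable_hrho : measurable_fun [set: 'rV[R]_n] (@hrho R n).
Proof.
have me := @measurable_enorm R n.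
apply: (@measurableT_comp _ _ _ _ _ _ (@ln R)) => //.
apply: measurable_funM; first exact: measurable_funD.
apply: (@measurableT_comp _ _ _ _ _ _ (fun t : R => t^-1)).
  exact: measurable_inv.
exact: measurable_funB.
Qed.

Lemma enorm_ge0 x : 0 <= enorm x.
Proof. exact: sqrtr_ge0. Qed.

(** ln(1 + r) >= 0 and -ln(1 - r) >= r. This replaces negative powers of [hrho] by those of the
    Euclidean norm. *)
Lemma hrho_ge x : hball x -> enorm x <= hrho x.
Proof.
rewrite /hball/= => x1; have x0 := enorm_ge0 x.
have y0 : 0 < 1 - enorm x by rewrite subr_gt0.
rewrite /hrho lnM ?posrE ?ltr_wpDr ?invr_gt0// lnV ?posrE//.
rewrite -[leLHS]add0r lerD//; first by rewrite ln_ge0// lerDl.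
by rewrite lerNr; have := le_ln1Dx (x := - enorm x); apply; rewrite ltrN2.
Qed.

Lemma enorm_eq0 x : enorm x = 0 -> x = 0.
Proof.
move=> x0; apply/rowP => j; rewrite mxE; apply/eqP; rewrite -normr_le0.
by rewrite -x0 coord_le_enorm.
Qed.

Lemma hgrad_partial (f : 'rV[R]_n -> R) i x : hball x ->
  `|partial i f x| <= 2 * e_ x * hlen x (hgrad f x).
Proof.
move=> xB; have e0 := e_gt0 xB.
have rE : 1 - enorm x ^+ 2 = (e_ x)^-1 by rewrite /e_ invrK enorm_sq.
have H : hlen x (hgrad f x) = (2 * e_ x)^-1 * enorm (\row_i partial i f x).
  rewrite /hlen /hmetric rE.
  rewrite (_ : _ / _ = (2 * e_ x)^-1 ^+ 2 * \sum_i (\row_i partial i f x) ord0 i ^+ 2).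
    rewrite sqrtrM ?sqr_ge0// sqrtr_sqr ger0_norm// invr_ge0 mulr_ge0// ltW//.
  under eq_bigr => j _.
    rewrite /hgrad mxE rE -expr2 exprMn; over.
  rewrite -mulr_sumr; move: (\sum_(_ < _) _) => S.
  by field; rewrite gt_eqF.
rewrite H mulrA mulfV ?mul1r; last by rewrite mulf_neq0// gt_eqF.
by have := coord_le_enorm (\row_i partial i f x) i; rewrite mxE.
Qed.

Lemma hmetric_ge0 x (v : 'rV[R]_n) : 0 <= hmetric x v v.
Proof.
rewrite divr_ge0 ?sqr_ge0// mulr_ge0// sumr_ge0// => i _.
by rewrite -expr2 sqr_ge0.
Qed.

Lemma hlen_ge0 x (v : 'rV[R]_n) : 0 <= hlen x v.
Proof. exact: sqrtr_ge0. Qed.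

Lemma measurable_hlen (V : 'rV[R]_n -> 'rV[R]_n) :
  measurable_fun [set: 'rV[R]_n] V ->
  measurable_fun [set: 'rV[R]_n] (fun x => hlen x (V x)).
Proof.
move=> mV.
have ms : measurable_fun [set: 'rV[R]_n] (fun x : 'rV[R]_n => 1 - enorm x ^+ 2).
  by apply: measurable_funB => //; apply: measurable_funX; exact: measurable_enorm.
apply: (@measurableT_comp _ _ _ _ _ _ (@Num.sqrt R)).
  by apply: continuous_measurable_fun; exact: sqrt_continuous.
apply: measurable_funM; last first.
  apply: (@measurableT_comp _ _ _ _ _ _ (fun t : R => t^-1)).
    exact: measurable_inv.
  exact: measurable_funX.
apply: measurable_funM => //; apply: measurable_sum => i.
have mVi := measurableT_comp (measurable_coord i) mV.
exact: (measurable_funM mVi mVi).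
Qed.

(** A triangle inequality with a loss, from 2 (|a|^2 + |b|^2) >= |a + b|^2 in each coordinate; the
    factor only enlarges the final constant. *)
Lemma hlen_subD x (u v : 'rV[R]_n) m :
  hlen x u ^+ m <= 2 ^+ m * (hlen x (u - v) ^+ m + hlen x v ^+ m).
Proof.
pose M := Num.max (hlen x (u - v)) (hlen x v).
have M0 : 0 <= M by rewrite le_max hlen_ge0.
have metricE w : hmetric x w w = hlen x w ^+ 2 by rewrite sqr_sqrtr// hmetric_ge0.
have uM : hlen x u <= 2 * M.
  rewrite -(@ler_pXn2r _ 2)// ?nnegrE ?hlen_ge0 ?mulr_ge0//.
  apply: (@le_trans _ _ (2 * (hlen x (u - v) ^+ 2) + 2 * (hlen x v ^+ 2))).
    rewrite -!metricE /hmetric.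
    set S1 := \sum_i _; set S2 := \sum_i _; set S3 := \sum_i _.
    have SS : S1 <= 2 * (S2 + S3).
      rewrite /S2 /S3 -big_split/= mulr_sumr; apply: ler_sum => i _.
      rewrite !mxE -subr_ge0.
      rewrite (_ : _ - _ = (u ord0 i - 2 * v ord0 i) ^+ 2) ?sqr_ge0//; ring.
    move: SS; move: S1 S2 S3 => S1 S2 S3 SS.
    rewrite (_ : 2 * (4 * S2 / _) + _ = 4 * (2 * (S2 + S3)) / (1 - enorm x ^+ 2) ^+ 2).
      by rewrite ler_wpM2r ?invr_ge0 ?sqr_ge0// ler_wpM2l.
    ring.
  rewrite exprMn (_ : 2 ^+ 2 * _ = 2 * M ^+ 2 + 2 * M ^+ 2); last by ring.
  by rewrite lerD// ler_wpM2l// lerXn2r ?nnegrE ?hlen_ge0// /M le_max lexx ?orbT.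
apply: (@le_trans _ _ ((2 * M) ^+ m)).
  by rewrite lerXn2r ?nnegrE ?hlen_ge0// mulr_ge0.
rewrite exprMn ler_wpM2l ?exprn_ge0// /M maxEle; case: ifP => _.
  by rewrite lerDr exprn_ge0// hlen_ge0.
by rewrite lerDl exprn_ge0// hlen_ge0.
Qed.

End hyperbolic_integral.

(** * Test functions and the conformal invariance of the energy *)

Section test_functions.
Context {R : realType} {n : nat}.
Local Notation L := (@lebesgue_rV R n.+2).
Local Notation N := n.+2.
Implicit Types f : 'rV[R]_N -> R.

Lemma updD i (x : 'rV[R]_N) (s h : R) :
  h *: delta_mx ord0 i + upd i x s = upd i x (h + s).
Proof.
apply/rowP => j; rewrite !mxE eqxx/=.
by case: eqVneq => _; rewrite ?mulr1// mulr0 add0r.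
Qed.

Lemma test_C1c f : test_function f ->
  C1c (closure [set x | f x != 0]) f (fun i => partial i f).
Proof.
move=> [sf cf fB]; split.
- exact: (sf [::]).1.
- by move=> i; exact: (sf [:: i]).1.
- move=> i x s; have := (sf [::]).2 i (upd i x s).
  rewrite /derivable/= => df.
  have E : (fun h : R => h^-1 *: ((((fun s => f (upd i x s)) \o shift s) (h *: (1 : R)) -
        f (upd i x s)) : R)) =
      (fun h : R => h^-1 *: ((f \o shift (upd i x s)) (h *: delta_mx ord0 i) -
        f (upd i x s))).
    by apply/funext => h /=; rewrite updD /GRing.scale/= mulr1.
  by apply: DeriveDef; rewrite /derivable /partial /derive E.
- move=> x Kx; apply: contrapT => fx; apply: Kx; apply: subset_closure.
  exact/eqP.
Qed.

Lemma measurable_hgrad_test f : test_function f ->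
  measurable_fun [set: 'rV[R]_N] (hgrad f).
Proof.
move=> /test_C1c cf; apply: measurable_rV => i.
under eq_fun do rewrite /hgrad !mxE.
apply: measurable_funM; last exact: measurable_C1c' cf.
apply: measurable_funM => //; apply: measurable_funX.
by apply: measurable_funB => //; apply: measurable_funX; exact: measurable_enorm.
Qed.

Lemma grad1_test f x : hball x ->
  grad1 (fun i => partial i f) x <= N%:R * (2 * e_ x * hlen x (hgrad f x)).
Proof.
move=> xB; rewrite mulr_natl -[X in _ *+ X]card_ord -sumr_const.
by apply: ler_sum => i _; exact: hgrad_partial.
Qed.

(** The factor (2 e_)^N that relates the Euclidean to the hyperbolic gradient is exactly the volume
    density; [N%:R ^+ N] is the price of the l^1 norm. *)
Lemma integral_grad1_test f : test_function f ->
  (\int[L]_x (grad1 (fun i => partial i f) x ^+ N)%:E <=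
   (N%:R ^+ N)%:E * \int[hvol]_x (hlen x (hgrad f x) ^+ N)%:E)%E.
Proof.
move=> tf; have cf := test_C1c tf; have [_ cK KB] := tf.
have mh := measurable_hlen (measurable_hgrad_test tf).
have hl0 x : 0 <= hlen x (hgrad f x) by exact: sqrtr_ge0.
rewrite integral_hvol; last 2 first.
- by apply/measurable_EFinP; exact: measurable_funX.
- by move=> x; rewrite lee_fin exprn_ge0.
have m1 : measurable_fun [set: 'rV[R]_N]
    (fun x => hlen x (hgrad f x) ^+ N * hdens x).
  by apply: measurable_funM; [exact: measurable_funX|exact: measurable_hdens].
have p1 x : 0 <= hlen x (hgrad f x) ^+ N * hdens x.
  by rewrite mulr_ge0 ?exprn_ge0 ?hdens_ge0.
under [X in (_ <= _ * X)%E]eq_integral do rewrite -EFinM.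
rewrite -(ge0_intZ _ _ m1)//.
apply: ge0_int_le => //.
- by apply: measurable_funX; exact: measurable_grad1 cf.
- exact: measurable_funM.
- by move=> x; rewrite exprn_ge0// grad1_ge0.
- move=> x; have [Kx|Kx] := pselect (closure [set x | f x != 0] x); last first.
    have -> : grad1 (fun i => partial i f) x = 0.
      by apply: big1 => i _; rewrite (C1c_supp' cK cf)// normr0.
    by rewrite expr0n mulr_ge0.
  have xB := KB _ Kx; rewrite /hdens indicE mem_set// mulr1.
  apply: (@le_trans _ _ ((N%:R * (2 * e_ x * hlen x (hgrad f x))) ^+ N)).
    rewrite lerXn2r ?nnegrE ?grad1_ge0 ?grad1_test// mulr_ge0// mulr_ge0// mulr_ge0//.
    by rewrite ltW// e_gt0.
  rewrite !exprMn [hlen _ _ ^+ _ * _]mulrC.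
  by move: (N%:R ^+ N : R) (2 ^+ N : R) (e_ x ^+ N) (_ ^+ N) => a b e h; lra.
Qed.

End test_functions.

(** * The singular inequality for test functions *)

Section singular_test.
Context {R : realType} {n : nat}.
Local Notation mu := (@lebesgue_measure R).
Local Notation L := (@lebesgue_rV R n.+2).
Local Notation N := n.+2.

Lemma prode_ge_exp m (F : 'I_m -> \bar R) (y : R) : 0 <= y ->
  (forall i, y%:E <= F i)%E -> ((y ^+ m)%:E <= \prod_(i < m) F i)%E.
Proof.
move=> y0; elim: m F => [|m IH] F yF; first by rewrite big_ord0 expr0.
rewrite big_ord_recl exprS EFinM lee_pmul ?lee_fin ?exprn_ge0//.
by apply: IH => i; exact: yF.
Qed.

Lemma powR_inv (x r : R) : 0 <= x -> x^-1 `^ r = (x `^ r)^-1.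
Proof. by move=> x0; rewrite -powR_inv1// -powRrM mulN1r powRN. Qed.

Variables (q beta : R).
Hypotheses (Nq : N%:R <= q) (beta_ge0 : 0 <= beta) (beta_ltN : beta < N%:R).

Let N_gt0 : 0 < N%:R :> R. Proof. by rewrite ltr0n. Qed.
Let q_gt0 : 0 < q. Proof. exact: lt_le_trans Nq. Qed.

(* Conjugate exponents, with [s > 1] chosen so that [beta * s < N]. *)
Let s := 2 * N%:R / (N%:R + beta).
Let s' := 2 * N%:R / (N%:R - beta).
Let gamma := 2 * beta / (N%:R + beta).

Let Nb_gt0 : 0 < N%:R + beta. Proof. by rewrite ltr_wpDr. Qed.
Let Nb'_gt0 : 0 < N%:R - beta. Proof. by rewrite subr_gt0. Qed.
Let s_gt0 : 0 < s. Proof. by rewrite divr_gt0// mulr_gt0. Qed.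
Let s'_gt0 : 0 < s'. Proof. by rewrite divr_gt0// mulr_gt0. Qed.
Let s'_ge1 : 1 <= s'.
Proof. by rewrite ler_pdivlMr// mul1r; move: N_gt0 beta_ge0; lra. Qed.
Let ss' : s^-1 + s'^-1 = 1.
Proof. by rewrite !invf_div -mulrDl (_ : _ + _ = 2 * N%:R) ?mulfV ?mulf_neq0 ?gt_eqF//; ring. Qed.
Let gamma_ge0 : 0 <= gamma. Proof. by rewrite divr_ge0 ?mulr_ge0// ltW. Qed.
Let gamma_lt1 : gamma < 1.
Proof. by rewrite ltr_pdivrMr// mul1r; move: beta_ltN; lra. Qed.
Let sgamma : beta * s = gamma * N%:R. Proof. by rewrite /s /gamma; ring. Qed.

(** By [sgamma], |x|^(-beta s) is the N-th power of |x|^(-gamma): each coordinate takes an equal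
    share of the singularity, integrable because [gamma < 1]. *)
Let Phi (x : 'rV[R]_N) := (\prod_(i < N) dyadic_weight gamma (x ord0 i))%E.

Let Phi_ge0 x : (0 <= Phi x)%E.
Proof. by apply: prode_ge0 => i; exact: dyadic_weight_ge0. Qed.

Let measurable_Phi : measurable_fun [set: 'rV[R]_N] Phi.
Proof. by apply: measurable_prod_rV; exact: measurable_dyadic_weight. Qed.

Let integral_Phi : (\int[L]_x Phi x)%E \is a fin_num.
Proof.
rewrite integral_prod_rV; last 2 first.
- exact: measurable_dyadic_weight.
- exact: dyadic_weight_ge0.
rewrite fin_numX// ge0_fin_numE.
  exact: integral_dyadic_weight_lty.
by apply: integral_ge0 => x _; exact: dyadic_weight_ge0.
Qed.

(** The first summand serves |x| >= 1/2, where rho^-beta <= 2^beta; the second is the power of [F]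
    left by Young's inequality near the origin. They integrate to multiples of A_q and A_(q s'). *)
Let majorant (F : R) (x : 'rV[R]_N) : R :=
  2 ^+ N * (2 `^ beta * (F `^ q * `|e_ x| ^+ N) + F `^ (q * s') * `|e_ x| ^+ N).

Let majorant_ge0 F x : 0 <= majorant F x.
Proof.
have E0 a : 0 <= F `^ a * `|e_ x| ^+ N by rewrite mulr_ge0 ?powR_ge0// exprn_ge0.
by rewrite mulr_ge0 ?exprn_ge0// addr_ge0// mulr_ge0// powR_ge0.
Qed.

(* Away from the origin [hrho] is bounded below; near it, Young's inequality
   separates the singular weight from [F], and [enorm x] dominates every
   coordinate, so that the weight is bounded by a product. *)
Lemma singular_pointwise (F : R) (x : 'rV[R]_N) : 0 <= F ->
  (((F / hrho x `^ (beta / q)) `^ q * hdens x)%:E <=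
   (majorant F x)%:E + (4 ^+ N)%:E * Phi x)%E.
Proof.
move=> F0.
have RHS0 : (0 <= (majorant F x)%:E + (4 ^+ N)%:E * Phi x)%E.
  by rewrite adde_ge0 ?lee_fin ?mule_ge0 ?lee_fin ?exprn_ge0.
have [xB|xB] := pselect (hball x); last first.
  by rewrite /hdens indicE memNset// !mulr0.
have e0 := e_gt0 xB; have r0 := enorm_ge0 x.
(* At the origin [hrho] is 0. If [beta] is nonzero, its power and the inverse of that power are 0,
   and the left side vanishes; if [beta = 0] the power is 1. *)
have [x0|x0] := eqVneq (enorm x) 0.
  have rho0 : hrho x = 0 by rewrite /hrho x0 addr0 subr0 divr1 ln1.
  have [b0|b0] := eqVneq beta 0; last first.
    have -> : hrho x `^ (beta / q) = 0.
      by rewrite rho0 powR0// mulf_neq0// invr_eq0 gt_eqF.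
    by rewrite invr0 mulr0 powR0 ?gt_eqF// mul0r.
  rewrite b0 mul0r powRr0 divr1 /hdens indicE mem_set// mulr1.
  apply: (@le_trans _ _ (majorant F x)%:E); last first.
    by rewrite leeDl// mule_ge0// lee_fin exprn_ge0.
  rewrite lee_fin /majorant b0 powRr0 mul1r gtr0_norm// mulrCA ler_wpM2l ?exprn_ge0//.
  by rewrite lerDl mulr_ge0 ?powR_ge0// exprn_ge0// ltW.
have {x0}r_gt0 : 0 < enorm x by rewrite lt_def x0.
have rho_ge := hrho_ge xB; have rho_gt0 := lt_le_trans r_gt0 rho_ge.
have E : (F / hrho x `^ (beta / q)) `^ q = F `^ q * hrho x `^ (- beta).
  rewrite powRM ?invr_ge0 ?powR_ge0//; congr (_ * _).
  by rewrite -powRN -powRrM mulNr divfK// gt_eqF.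
have rhor : hrho x `^ (- beta) <= enorm x `^ (- beta).
  by rewrite !powRN lef_pV2 ?posrE ?powR_gt0//; apply: ge0_ler_powR; rewrite ?nnegrE ?(ltW r_gt0) ?(ltW rho_gt0).
rewrite E /hdens indicE mem_set// mulr1.
have [r2|r2] := leP 2^-1 (enorm x).
  apply: (@le_trans _ _ (majorant F x)%:E); last first.
    by rewrite leeDl// mule_ge0// lee_fin exprn_ge0.
  rewrite lee_fin /majorant gtr0_norm// mulrCA ler_wpM2l ?exprn_ge0//.
  apply: (@le_trans _ _ (2 `^ beta * (F `^ q * e_ x ^+ N))); last first.
    by rewrite lerDl mulr_ge0 ?powR_ge0// exprn_ge0// ltW.
  rewrite [leRHS]mulrA ler_wpM2r ?exprn_ge0 ?(ltW e0)// mulrC ler_wpM2r ?powR_ge0//.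
  apply: le_trans rhor _; rewrite powRN -[leLHS]mul1r ler_pdivrMr ?powR_gt0//.
  have E2 : 2 `^ beta * 2^-1 `^ beta = 1 :> R by rewrite -powRM// mulfV// powR1.
  rewrite -[leLHS]E2 ler_wpM2l ?powR_ge0//.
  by apply: ge0_ler_powR; rewrite ?nnegrE ?(ltW r_gt0).
have Y : F `^ q * enorm x `^ (- beta) <= F `^ (q * s') + enorm x `^ (- gamma) ^+ N.
  have := conjugate_powR (powR_ge0 (enorm x) (- beta)) (powR_ge0 F q) s_gt0 s'_gt0 ss'.
  rewrite mulrC => /le_trans; apply; rewrite -!powRrM mulNr sgamma addrC lerD//.
    by rewrite ler_pdivrMr// ler_peMr ?powR_ge0.
  rewrite -mulNr powRrM powR_mulrn ?powR_ge0// ler_pdivrMr// ler_peMr//.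
    by rewrite exprn_ge0// powR_ge0.
  by rewrite ler_pdivlMr// mul1r; move: beta_ltN; lra.
have PhiE : ((enorm x `^ (- gamma) ^+ N)%:E <= Phi x)%E.
  apply: prode_ge_exp => [|i]; first exact: powR_ge0.
  apply: dyadic_weight_ge => //; last exact: coord_le_enorm.
(* Hence the density is at most [4 ^+ N] for |x| < 1/2, the coefficient of [Phi]. *)
have e2 : e_ x <= 2.
  rewrite /e_ invf_ple ?posrE//; last by rewrite -invr_gt0.
  rewrite -enorm_sq lerBrDr -lerBrDl.
  apply: (@le_trans _ _ (2^-1 ^+ 2)); last by lra.
  by rewrite lerXn2r ?nnegrE// ltW.
apply: (@le_trans _ _ ((majorant F x)%:E +
    (4 ^+ N)%:E * (enorm x `^ (- gamma) ^+ N)%:E)%E); last first.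
  by rewrite leeD2l// lee_wpmul2l// lee_fin exprn_ge0.
rewrite -EFinM -EFinD lee_fin.
apply: (@le_trans _ _ ((F `^ (q * s') + enorm x `^ (- gamma) ^+ N) * (2 ^+ N * e_ x ^+ N))).
  apply: ler_wpM2r.
    by apply: mulr_ge0; apply: exprn_ge0 => //; exact: ltW.
  by apply: le_trans Y; rewrite ler_wpM2l ?powR_ge0.
rewrite mulrDl lerD//.
  rewrite /majorant gtr0_norm// mulrCA ler_wpM2l ?exprn_ge0// lerDr.
  apply: mulr_ge0; first exact: powR_ge0.
  by rewrite mulr_ge0 ?powR_ge0// exprn_ge0// ltW.
rewrite mulrC ler_wpM2r; last 2 first.
- by rewrite exprn_ge0// powR_ge0.
- rewrite -exprMn lerXn2r ?nnegrE//; first by rewrite mulr_ge0// ltW.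
  by rewrite (_ : 4 = 2 * 2 :> R) ?ler_wpM2l//; ring.
- by [].
Qed.

Lemma singular_test : exists C : R, 0 <= C /\
  forall (f : 'rV[R]_N -> R) (D : R), test_function f -> 0 < D ->
  (\int[hvol]_x (hlen x (hgrad f x) ^+ N)%:E <= D%:E)%E ->
  (\int[hvol]_x (`|f x / hrho x `^ (beta / q)| `^ q)%:E <=
   (C * D `^ (q / N%:R))%:E)%E.
Proof.
have [C1 [C1_ge0 C1P]] := wint_bounded Nq.
have Nqs : N%:R <= q * s'.
  by apply: le_trans Nq _; rewrite ler_peMr// ltW.
have [C2 [C2_ge0 C2P]] := wint_bounded Nqs.
pose P : R := fine (\int[L]_x Phi x)%E.
have P0 : 0 <= P by apply: fine_ge0; exact: integral_ge0.
pose K0 := 2 ^+ N * (2 `^ beta * C1 + C2) + 4 ^+ N * P.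
have K00 : 0 <= K0.
  by rewrite addr_ge0// mulr_ge0 ?exprn_ge0// addr_ge0// mulr_ge0// powR_ge0.
exists (N%:R `^ q * K0); split; first by rewrite mulr_ge0// powR_ge0.
move=> f D tf D0 fD; have cf := test_C1c tf; have [_ cK KB] := tf.
(* The integral of [grad1 ^+ N] for [f] is at most [N%:R ^+ N * D], hence at most 1 for [c * f]. *)
pose c := (N%:R * D `^ N%:R^-1)^-1.
have c0 : 0 < c by rewrite invr_gt0 mulr_gt0// powR_gt0.
have cN : c ^+ N * (N%:R ^+ N * D) = 1.
  have DN : (D `^ N%:R^-1) ^+ N = D.
    by rewrite -powR_mulrn ?powR_ge0// -powRrM mulVf ?gt_eqF// powRr1// ltW.
  rewrite /c exprVn exprMn DN mulVf// mulf_neq0// ?expf_neq0// gt_eqF//.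
have ctf : C1c (closure [set x | f x != 0]) ( *%R c \o f)
    (fun i x => c * partial i f x).
  apply: (C1c_comp cf (phi' := cst c)).
  - move=> t; have := @is_deriveZ R R R id c t 1 1 (is_derive_id _ _).
    by rewrite /GRing.scale/= mulr1.
  - by move=> t; exact: cvg_cst.
  - by rewrite mulr0.
have mgr := measurable_grad1 cf.
have gE x : grad1 (fun i x => c * partial i f x) x = c * grad1 (fun i => partial i f) x.
  by rewrite /grad1 mulr_sumr; apply: eq_bigr => i _; rewrite normrM gtr0_norm.
have gD : (\int[L]_x (grad1 (fun i x => c * partial i f x) x ^+ N)%:E <= 1)%E.
  under eq_integral do rewrite gE exprMn.
  have mgN : measurable_fun [set: 'rV[R]_N] (fun x => grad1 (fun i => partial i f) x ^+ N).
    exact: measurable_funX.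
  have gN0 x : 0 <= grad1 (fun i => partial i f) x ^+ N by rewrite exprn_ge0// grad1_ge0.
  have cN0 : 0 <= c ^+ N by rewrite exprn_ge0// ltW.
  rewrite (ge0_intZ L cN0 mgN gN0).
  apply: (@le_trans _ _ ((c ^+ N)%:E * ((N%:R ^+ N)%:E * D%:E))%E).
    rewrite lee_wpmul2l//; apply: le_trans (integral_grad1_test tf) _.
    by rewrite lee_wpmul2l ?lee_fin ?exprn_ge0.
  by rewrite -!EFinM cN.
have W1 := C1P _ _ _ cK KB ctf gD.
have W2 := C2P _ _ _ cK KB ctf gD.
have mf := measurable_C1c cf.
have mrho : measurable_fun [set: 'rV[R]_N] (fun x => hrho x `^ (beta / q)).
  by apply: (measurableT_comp (measurable_powR _)); exact: measurable_hrho.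
have mw : measurable_fun [set: 'rV[R]_N] (fun x => (hrho x `^ (beta / q))^-1).
  apply: (@measurableT_comp _ _ _ _ _ _ (fun t : R => t^-1)) => //.
  exact: measurable_inv.
have minteg : measurable_fun [set: 'rV[R]_N]
    (fun x => `|f x / hrho x `^ (beta / q)| `^ q).
  apply: (measurableT_comp (measurable_powR _)); apply: measurableT_comp => //.
  exact: measurable_funM.
rewrite integral_hvol; last 2 first.
- exact/measurable_EFinP.
- by move=> x; rewrite lee_fin powR_ge0.
have fE x : `|f x / hrho x `^ (beta / q)| `^ q * hdens x =
    (c `^ q)^-1 * ((`|c * f x| / hrho x `^ (beta / q)) `^ q * hdens x).
  rewrite !normrM (gtr0_norm c0) normfV; move: (`|f x|) (normr_ge0 (f x)) => F F0.
  rewrite ger0_norm ?powR_ge0//.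
  have h0 : 0 <= (hrho x `^ (beta / q))^-1 by rewrite invr_ge0 powR_ge0.
  rewrite -[c * F * _]mulrA [in RHS](powRM _ (ltW c0) (mulr_ge0 F0 h0)).
  by rewrite -[in RHS]mulrA mulKf// gt_eqF// powR_gt0.
have cq : (c `^ q)^-1 = N%:R `^ q * D `^ (q / N%:R).
  have -> : (c `^ q)^-1 = c^-1 `^ q.
    by rewrite powR_inv// ltW.
  by rewrite /c invrK powRM ?powR_ge0// -powRrM [_^-1 * q]mulrC.
under eq_integral do rewrite -EFinM fE.
have mG : measurable_fun [set: 'rV[R]_N]
    (fun x => (`|c * f x| / hrho x `^ (beta / q)) `^ q * hdens x).
  apply: measurable_funM; last exact: measurable_hdens.
  apply: (measurableT_comp (measurable_powR _)); apply: measurable_funM => //.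
  by apply: measurableT_comp => //; exact: measurable_funM.
have G0 x : 0 <= (`|c * f x| / hrho x `^ (beta / q)) `^ q * hdens x.
  by rewrite mulr_ge0 ?powR_ge0 ?hdens_ge0.
rewrite ge0_intZ// ?invr_ge0 ?powR_ge0// cq.
rewrite [in leRHS]mulrAC [leRHS]EFinM.
rewrite lee_wpmul2l ?lee_fin ?mulr_ge0 ?powR_ge0//.
have mw1 := measurable_wint ctf q.
have mw2 := measurable_wint ctf (q * s').
have mmaj : measurable_fun [set: 'rV[R]_N] (fun x => majorant `|c * f x| x).
  apply: measurable_funM => //; apply: measurable_funD; last exact: mw2.
  by apply: measurable_funM => //; exact: mw1.
apply: (@le_trans _ _ (\int[L]_x ((majorant `|c * f x| x)%:E + (4 ^+ N)%:E * Phi x))%E).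
  apply: ge0_le_integral => //.
  - by move=> x _; rewrite lee_fin.
  - exact/measurable_EFinP.
  - apply: emeasurable_funD; first exact/measurable_EFinP.
    exact: measurable_funeM.
  - by move=> x _; exact: singular_pointwise.
rewrite ge0_integralD//; last 4 first.
- by move=> x _; rewrite lee_fin.
- exact/measurable_EFinP.
- by move=> x _; rewrite mule_ge0// lee_fin exprn_ge0.
- exact: measurable_funeM.
rewrite /K0 EFinD leeD//; last first.
  rewrite ge0_integralZl_EFin ?exprn_ge0//.
  by rewrite [leRHS]EFinM /P fineK.
have w0 t x : 0 <= `|c * f x| `^ t * `|e_ x| ^+ N.
  by rewrite mulr_ge0 ?powR_ge0// exprn_ge0.
have mw1' : measurable_fun [set: 'rV[R]_N]
    (fun x => 2 `^ beta * (`|c * f x| `^ q * `|e_ x| ^+ N)).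
  exact: measurable_funM.
have w0' x : 0 <= 2 `^ beta * (`|c * f x| `^ q * `|e_ x| ^+ N).
  by rewrite mulr_ge0// powR_ge0.
have mA := measurable_funD mw1' mw2.
have A0 x : 0 <= 2 `^ beta * (`|c * f x| `^ q * `|e_ x| ^+ N) +
    `|c * f x| `^ (q * s') * `|e_ x| ^+ N by exact: addr_ge0.
have two0 : 0 <= 2 ^+ N :> R by exact: exprn_ge0.
rewrite [leLHS](ge0_intZ L two0 mA A0) [leRHS]EFinM lee_wpmul2l//.
rewrite (ge0_intD L mw1' mw2)// (ge0_intZ L _ mw1)// ?powR_ge0// EFinD.
by apply: leeD => //; rewrite [leRHS]EFinM lee_wpmul2l// lee_fin powR_ge0.
Qed.

End singular_test.

(** * Passage to the completion *)

Section fatou_subsequence.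
Context d (T : measurableType d) (R : realType) (mu : {measure set T -> \bar R}).

Lemma continuous_norm_powR (q : R) : 0 < q -> continuous (fun t : R => `|t| `^ q).
Proof.
move=> q0 t; have [->|t0] := eqVneq t 0.
  suff : (`|x| `^ q) @[x --> (0 : R)] --> `|0 : R| `^ q by [].
  rewrite normr0 powR0 ?gt_eqF//; apply/cvgrPdist_lt => e e0; near=> x.
  rewrite sub0r normrN ger0_norm ?powR_ge0//.
  have xe : `|x| < e `^ q^-1.
    near: x; apply: (@nbhs0_lt R R); exact: powR_gt0.
  have := gt0_ltr_powR q0 _ _ xe; rewrite !nnegrE powR_ge0 normr_ge0 => /(_ isT isT).
  by rewrite -powRrM mulVf ?gt_eqF// powRr1// ltW.
apply: (@continuous_comp _ _ _ (fun t : R => `|t|) (fun a => a `^ q)).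
  exact: norm_continuous.
apply/differentiable_continuous/derivable1_diffP.
by apply: derivable_powR; rewrite in_itv/= andbT normr_gt0.
Unshelve. all: by end_near. Qed.

Local Open Scope ereal_scope.

Lemma limn_einf_le_cst (u : (\bar R)^nat) (B : \bar R) :
  (forall j, u j <= B) -> limn_einf u <= B.
Proof.
move=> uB; rewrite limn_einf_lim; apply: lime_le; first exact: is_cvg_einfs.
apply: nearW => j; apply: le_trans (uB j).
by apply: ereal_inf_lbound; exists j => /=.
Qed.

Lemma nneseries_cvg0 (u : nat -> R) : (forall j, 0 <= u j)%R ->
  \sum_(0 <= j <oo) (u j)%:E < +oo -> u @ \oo --> (0 : R)%R.
Proof.
move=> u0 ufin.
have uE0 : forall j, xpredT j -> 0 <= (u j)%:E by move=> j _; rewrite lee_fin.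
have tail := nneseries_tail_cvg ufin uE0.
suff : (fun j => (u j)%:E) @ \oo --> 0%:E by move/fine_cvg.
apply: (@squeeze_cvge _ _ _ _ (cst 0) _ _ _ _ _ tail); last exact: cvg_cst.
apply: nearW => j; rewrite lee_fin u0/=.
have := @nneseries_lim_ge R (fun j => (u j)%:E) xpredT j j.+1 (fun k _ => uE0 k).
by rewrite big_nat1.
Qed.

(** The bounds 2^-(j+1) make the series of the |psi_j - f|^(m+1) integrable, hence finite almost
    everywhere, so psi_j tends to [f] almost everywhere. Multiplication by the fixed weight [W]
    preserves this, and Fatou's lemma concludes. *)
Lemma fatou_fast_cvg (psi : nat -> T -> R) (f W : T -> R) (m : nat) (q : R)
    (B : \bar R) :
  (forall j, measurable_fun setT (psi j)) -> measurable_fun setT f ->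
  measurable_fun setT W -> (0 < q)%R ->
  (forall j, \int[mu]_x (`|psi j x - f x| ^+ m.+1)%:E <= (1 / (2 ^ j.+1)%:R)%:E) ->
  (forall j, \int[mu]_x (`|psi j x * W x| `^ q)%:E <= B) ->
  \int[mu]_x (`|f x * W x| `^ q)%:E <= B.
Proof.
move=> mpsi mf mW q0 fast psiB.
have mterm j : measurable_fun setT (fun x => (`|psi j x - f x| ^+ m.+1)%:E).
  apply/measurable_EFinP; apply: measurable_funX; apply: measurableT_comp => //.
  exact: measurable_funB.
have term0 j x : 0 <= (`|psi j x - f x| ^+ m.+1)%:E by rewrite lee_fin exprn_ge0.
pose S x := \sum_(0 <= j <oo) (`|psi j x - f x| ^+ m.+1)%:E.
have mS : measurable_fun setT S by exact: ge0_emeasurable_sum.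
have S0 x : 0 <= S x by apply: nneseries_ge0.
have iS : mu.-integrable setT S.
  apply/integrableP; split => //.
  under eq_integral do rewrite gee0_abs//.
  rewrite integral_nneseries//; apply: (@le_lt_trans _ _ 1%:E); last exact: ltry.
  apply: le_trans (epsilon_trick0 xpredT (ler01 : (0 <= 1 :> R)%R)).
  by apply: lee_nneseries => [j _ _|j _]; [exact: integral_ge0|exact: fast].
have cvg_psi : {ae mu, forall x, psi ^~ x @ \oo --> f x}.
  apply: filterS (integrable_ae measurableT iS) => x /(_ I) Sfin.
  have /nneseries_cvg0 cv0 : \sum_(0 <= j <oo) (`|psi j x - f x| ^+ m.+1)%:E < +oo.
    by move: Sfin; rewrite ge0_fin_numE.
  have {}cv0 := cv0 (fun j => exprn_ge0 _ (normr_ge0 _)).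
  apply/cvgrPdist_lt => e e0; near=> j.
  rewrite distrC -(@ltr_pXn2r _ m.+1)// ?nnegrE//; last exact: ltW.
  have : (`|0 - `|psi j x - f x| ^+ m.+1| < e ^+ m.+1)%R.
    by near: j; move/cvgrPdist_lt : cv0; apply; rewrite exprn_gt0.
  by rewrite sub0r normrN ger0_norm// exprn_ge0.
have mpow (h : T -> R) : measurable_fun setT h ->
    measurable_fun setT (fun x => (`|h x * W x| `^ q)%:E).
  move=> mh; apply/measurable_EFinP; apply: (measurableT_comp (measurable_powR _)).
  by apply: measurableT_comp => //; exact: measurable_funM.
have mg j := mpow _ (mpsi j).
have g0 j x : setT x -> 0 <= (`|psi j x * W x| `^ q)%:E.
  by move=> _; rewrite lee_fin powR_ge0.
have Fatou := fatou mu measurableT mg g0.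
apply: le_trans (le_trans Fatou (limn_einf_le_cst psiB)).
apply: ae_ge0_le_integral => //.
- exact: (mpow f mf).
- move=> x _; rewrite limn_einf_lim; apply: lime_ge; first exact: is_cvg_einfs.
  apply: nearW => j; apply: le_ereal_inf_tmp => _ [k _ <-].
  by rewrite lee_fin powR_ge0.
- apply: (emeasurable_fun_cvg (fun n x => einfs (fun j => (`|psi j x * W x| `^ q)%:E) n)).
    by move=> n; exact: measurable_fun_einfs.
  by move=> x _; rewrite limn_einf_lim; exact: is_cvg_einfs.
- apply: filterS cvg_psi => x cx _.
  have cW : (psi j x * W x)%R @[j --> \oo] --> (f x * W x)%R.
    by apply: cvgM => //; exact: cvg_cst.
  have cE : (`|psi j x * W x| `^ q)%:E @[j --> \oo] --> (`|f x * W x| `^ q)%:E.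
    apply: cvg_EFin; first exact: nearW.
    have cR := cvg_comp _ _ cW (@continuous_norm_powR q q0 (f x * W x)%R).
    exact: cR.
  by rewrite is_cvg_limn_einfE; [rewrite (cvg_lim _ cE)|apply/cvg_ex; eexists; exact: cE].
Unshelve. all: by end_near. Qed.

End fatou_subsequence.

Section sobolev_closure.
Context {R : realType} {n : nat}.
Local Notation N := n.+2.
Local Open Scope ereal_scope.

Definition energy (f : sobolev R N) : \bar R :=
  \int[hvol]_x (hlen x (sob_grad f x) ^+ N)%:E.

Lemma energy_ge0 (f : sobolev R N) : 0 <= energy f.
Proof. by apply: integral_ge0 => x _; rewrite lee_fin exprn_ge0// hlen_ge0. Qed.

Section bound.
Variables q beta C : R.
Hypotheses (q_gt0 : (0 < q)%R) (C_ge0 : (0 <= C)%R).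
Hypothesis test : forall (phi : 'rV[R]_N -> R) (D : R), test_function phi -> (0 < D)%R ->
  \int[hvol]_x (hlen x (hgrad phi x) ^+ N)%:E <= D%:E ->
  \int[hvol]_x (`|phi x / hrho x `^ (beta / q)| `^ q)%:E <= (C * D `^ (q / N%:R))%:E.

Let sing (f : 'rV[R]_N -> R) := \int[hvol]_x (`|f x / hrho x `^ (beta / q)| `^ q)%:E.

(** The approximants have energy at most 2^N times that of [f] plus an error tending to 0; the
    strict inequality leaves room for the error. *)
Let sobolev_bound_gt (f : sobolev R N) (D : R) : (2 ^+ N)%:E * energy f < D%:E ->
  sing f <= (C * D `^ (q / N%:R))%:E.
Proof.
move=> fD.
have D0 : (0 < D)%R.
  by rewrite -lte_fin (le_lt_trans _ fD)// mule_ge0 ?energy_ge0// lee_fin exprn_ge0.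
have [phi [tphi phi0]] := sob_approx f.
have mG := sob_grad_measurable f; have mf := sob_fun_measurable f.
have mphi k : measurable_fun [set: 'rV[R]_N] (phi k).
  exact: measurable_C1c (test_C1c (tphi k)).
have mgrad k : measurable_fun [set: 'rV[R]_N]
    (fun x => hlen x (hgrad (phi k) x - sob_grad f x)).
  apply: (measurable_hlen (V := fun x => hgrad (phi k) x - sob_grad f x)%R).
  apply: measurable_rV => i; under eq_fun do rewrite !mxE.
  apply: measurable_funB.
    have := measurableT_comp (measurable_coord i) (measurable_hgrad_test (tphi k)).
    by apply: eq_measurable_fun => x _ /=; rewrite !mxE.
  exact: (measurableT_comp (measurable_coord i) mG).
set a := (fun k => _) in phi0.
have aE k : a k = \int[hvol]_x (hlen x (hgrad (phi k) x - sob_grad f x) ^+ N)%:E +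
    \int[hvol]_x (`|phi k x - f x| ^+ N)%:E.
  rewrite /a ge0_intD//.
  - exact: measurable_funX.
  - apply: measurable_funX; apply: measurableT_comp => //; exact: measurable_funB.
  - by move=> x; rewrite exprn_ge0// hlen_ge0.
have a1 k : \int[hvol]_x (hlen x (hgrad (phi k) x - sob_grad f x) ^+ N)%:E <= a k.
  by rewrite aE leeDl//; apply: integral_ge0 => x _; rewrite lee_fin exprn_ge0.
have a2 k : \int[hvol]_x (`|phi k x - f x| ^+ N)%:E <= a k.
  by rewrite aE leeDr//; apply: integral_ge0 => x _; rewrite lee_fin exprn_ge0// hlen_ge0.
have small (e : R) : (0 < e)%R -> exists k, a k <= e%:E.
  move=> e0; have : nbhs (0 : \bar R) (fun u => u < e%:E).
    by apply: open_ereal_lt'; rewrite lte_fin.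
  move/phi0.
  by case=> k _ /(_ k (leqnn k)) /ltW ake; exists k.
have Efin : energy f \is a fin_num.
  rewrite ge0_fin_numE ?energy_ge0// ltey; apply/eqP => Eoo.
  by move: fD; rewrite Eoo gt0_muley// lte_fin exprn_gt0.
have [E EE] : exists E : R, energy f = E%:E by exists (fine (energy f)); rewrite fineK.
move: fD; rewrite EE -EFinM lte_fin => fD.
(* The solution of 2^N (eps + E) = D. *)
pose eps := ((D - 2 ^+ N * E) / 2 ^+ N)%R.
have eps0 : (0 < eps)%R by rewrite divr_gt0 ?subr_gt0// exprn_gt0.
(* The first bound gives the rapid convergence, the second keeps the energies below [D]. *)
have /choice[k kP] : forall j, exists k, a k <= (Num.min (1 / (2 ^ j.+1)%:R) eps)%:E.
  by move=> j; apply: small; rewrite lt_min eps0 andbT divr_gt0// ltr0n expn_gt0.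
have mw : measurable_fun [set: 'rV[R]_N] (fun x => (hrho x `^ (beta / q))^-1)%R.
  apply: (@measurableT_comp _ _ _ _ _ _ (fun t : R => t^-1)%R).
    exact: measurable_inv.
  by apply: (measurableT_comp (measurable_powR _)); exact: measurable_hrho.
apply: (@fatou_fast_cvg _ _ R hvol (fun j => phi (k j)) f _ n.+1 q) => //.
- move=> j; apply: le_trans (a2 (k j)) (le_trans (kP j) _).
  by rewrite lee_fin ge_min lexx.
- move=> j; apply: test => //.
  apply: (@le_trans _ _ (\int[hvol]_x (2 ^+ N *
    (hlen x (hgrad (phi (k j)) x - sob_grad f x) ^+ N + hlen x (sob_grad f x) ^+ N))%:E)).
    apply: ge0_int_le.
    + apply: measurable_funX; exact: measurable_hlen (measurable_hgrad_test _).
    + apply: measurable_funM => //; apply: measurable_funD; apply: measurable_funX => //.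
      exact: measurable_hlen.
    + by move=> x; rewrite exprn_ge0// hlen_ge0.
    + by move=> x; exact: hlen_subD.
  have m1 : measurable_fun [set: 'rV[R]_N]
      (fun x => hlen x (hgrad (phi (k j)) x - sob_grad f x) ^+ N)%R by exact: measurable_funX.
  have m2 : measurable_fun [set: 'rV[R]_N] (fun x => hlen x (sob_grad f x) ^+ N)%R.
    by apply: measurable_funX; exact: measurable_hlen.
  have p0 x (v : 'rV[R]_N) : (0 <= hlen x v ^+ N)%R by rewrite exprn_ge0// hlen_ge0.
  have two0 : (0 <= 2 ^+ N :> R)%R by rewrite exprn_ge0.
  rewrite (ge0_intZ _ two0 (measurable_funD m1 m2)); last by move=> x; rewrite addr_ge0.
  rewrite ge0_intD// -/(energy f) EE.
  apply: (@le_trans _ _ ((2 ^+ N)%:E * (eps%:E + E%:E))).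
    rewrite lee_wpmul2l// leeD2r//; apply: le_trans (a1 (k j)) (le_trans (kP j) _).
    by rewrite lee_fin ge_min lexx orbT.
  by rewrite -EFinD -EFinM lee_fin mulrDr /eps mulrCA mulfV ?mulr1 ?subrK.
Qed.

(* For energy [0] the bound is obtained by letting [D] tend to [0]. *)
Lemma sobolev_bound (f : sobolev R N) :
  sing f <= ((C + 1) * (2 * 2 ^+ N) `^ (q / N%:R))%:E * energy f `^ (q / N%:R).
Proof.
have qN : (0 < q / N%:R)%R by rewrite divr_gt0.
(* [C] may be 0. A positive constant is needed for division when the energy is 0, and for an
   infinite right side when it is infinite. *)
have C1 : (0 < C + 1)%R by rewrite ltr_wpDl.
have two0 : (0 < 2 ^+ N :> R)%R by rewrite exprn_gt0.
have K0 : (0 < (C + 1) * (2 * 2 ^+ N) `^ (q / N%:R))%R.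
  by rewrite mulr_gt0// powR_gt0// mulr_gt0.
have E0 := energy_ge0 f.
have [Eoo|Efin] := eqVneq (energy f) +oo.
  by rewrite Eoo poweRyr ?gt_eqF// gt0_muley ?leey// lte_fin.
have [E EE] : exists E : R, energy f = E%:E.
  by exists (fine (energy f)); rewrite fineK// ge0_fin_numE// ltey.
move: E0; rewrite EE lee_fin le_eqVlt => /predU1P[E0|E0].
  rewrite -E0 poweR_EFin powR0 ?gt_eqF// mule0; apply/lee_addgt0Pr => e e0.
  (* Chosen so that (C + 1) D^(q/N) = e. *)
  rewrite add0e; pose D := ((e / (C + 1)) `^ (q / N%:R)^-1)%R.
  have D0 : (0 < D)%R by rewrite powR_gt0// divr_gt0.
  apply: le_trans (@sobolev_bound_gt f D _) _.
    by rewrite EE -E0 mule0 lte_fin.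
  rewrite lee_fin /D -powRrM mulVf ?gt_eqF// powRr1; last by rewrite ltW// divr_gt0.
  by rewrite mulrCA ler_piMr ?ltW// ltr_pdivrMr// mul1r ltrDl.
apply: le_trans (@sobolev_bound_gt f (2 * 2 ^+ N * E)%R _) _.
  have twoE : (0 < 2 ^+ N * E)%R by rewrite mulr_gt0.
  by rewrite EE -EFinM lte_fin -mulrA ltr_pMl// ltr1n.
have twoE : (0 <= 2 * 2 ^+ N :> R)%R by rewrite mulr_ge0// ltW.
rewrite poweR_EFin -EFinM lee_fin powRM// ?(ltW E0)// mulrA ler_wpM2r ?powR_ge0//.
by rewrite ler_wpM2r ?powR_ge0// lerDl.
Qed.

End bound.

Lemma grad_normE (f : sobolev R N) : grad_norm f = energy f `^ N%:R^-1.
Proof.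
rewrite /grad_norm /hLnorm unlock /energy; congr (_ `^ _).
apply: eq_integral => x _ /=.
by rewrite ger0_norm ?hlen_ge0// powR_mulrn// hlen_ge0.
Qed.

Lemma singular_sobolev_exists (q beta : R) :
  (N%:R <= q)%R -> (0 <= beta)%R -> (beta < N%:R)%R ->
  exists2 C : R, (0 < C)%R & singular_sobolev N beta q C.
Proof.
move=> Nq b0 bN.
have q0 : (0 < q)%R by rewrite (lt_le_trans _ Nq).
have [C [C0 test]] := singular_test Nq b0 bN.
pose K := ((C + 1) * (2 * 2 ^+ N) `^ (q / N%:R))%R.
have K0 : (0 < K)%R by rewrite mulr_gt0 ?ltr_wpDl// powR_gt0// mulr_gt0// exprn_gt0.
(* The explicit factor of [singular_sobolev], divided out of the constant. *)
pose w := (q `^ (1 - N%:R^-1))%R.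
have w0 : (0 < w)%R by rewrite powR_gt0.
exists (K `^ q^-1 / w)%R; first by rewrite divr_gt0// powR_gt0.
move=> f; rewrite -/w divfK ?gt_eqF// grad_normE /hLnorm unlock.
have := sobolev_bound q0 C0 test f; rewrite -/K => H.
have qi : (0 <= q^-1)%R by rewrite invr_ge0 ltW.
apply: le_trans (gt0_ler_poweR qi _ _ H) _.
- by rewrite in_itv/= leey andbT; apply: integral_ge0 => x _; rewrite lee_fin powR_ge0.
- rewrite in_itv/= leey andbT; apply: mule_ge0; last exact: poweR_ge0.
  by rewrite lee_fin ltW.
rewrite poweRM ?poweR_ge0 ?lee_fin ?(ltW K0)// -poweRrM poweR_EFin.
by rewrite mulrAC mulfV ?mul1r// gt_eqF.
Qed.

End sobolev_closure.

(** * Interpolation *)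

Section interpolation.
Context {R : realType} {n : nat}.
Local Notation N := n.+2.
Local Notation L := (@lebesgue_rV R n.+2).

Lemma hLnormE p (w : 'rV[R]_N -> R) :
  hLnorm p w = ((\int[hvol]_x (`|w x| `^ p)%:E) `^ p^-1)%E.
Proof. by rewrite /hLnorm unlock. Qed.

Lemma Lnorm_powR (g : 'rV[R]_N -> R) a r :
  Lnorm hvol r%:E (EFin \o (fun x => `|g x| `^ a)) =
  ((\int[hvol]_x (`|g x| `^ (a * r))%:E) `^ r^-1)%E.
Proof.
rewrite unlock.
by under eq_integral => x _ do rewrite /= ger0_norm ?powR_ge0// -powRrM.
Qed.

(** The factorisation of rho^c f requires rho > 0. Off the ball the volume has no mass, and the
    origin lies in a null hyperplane. *)
Lemma ae_hball_neq0 : {ae (@hvol R N), forall x, hball x /\ x != 0}.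
Proof.
pose H := [set x : 'rV[R]_N | x ord0 ord0 = 0].
have mH : measurable H.
  rewrite (_ : H = (fun x : 'rV[R]_N => x ord0 ord0) @^-1` [set 0])//.
  by rewrite -[_ @^-1` _]setTI; apply: measurable_coord.
have mB := @measurable_hball R N.
exists (~` hball `|` H); split.
- by apply: measurableU => //; exact: measurableC.
- rewrite [LHS](_ : _ = \int[L]_(x in (~` hball `|` H) `&` hball) (hdensity x)%:E)%E//.
  have mHB := measurableI _ _ mH mB.
  have mdens : measurable_fun (H `&` hball) (fun x => (hdensity x)%:E : \bar R).
    by apply/measurable_EFinP; apply: measurable_funS (@measurable_hdensity R N).
  rewrite setIUl setICl set0U (null_set_integral mHB mdens)//.
  apply/eqP; rewrite eq_le measure_ge0 andbT.
  rewrite -[leRHS](@lebesgue_rV_hyperplane R n.+1).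
  by apply: le_measure; rewrite ?inE.
- move=> x /= xP; apply: contrapT => /not_orP[/contrapT xB xH]; apply: xP; split=> //.
  by apply/eqP => x0; apply: xH; rewrite /H/= x0 mxE.
Qed.

Lemma hrho_gt0 (x : 'rV[R]_N) : hball x -> x != 0 -> 0 < hrho x.
Proof.
move=> xB x0; apply: lt_le_trans (hrho_ge xB); rewrite lt_def enorm_ge0 andbT.
by apply: contra x0 => /eqP/enorm_eq0 ->.
Qed.

Lemma measurable_hrho_powR a :
  measurable_fun [set: 'rV[R]_N] (fun x => hrho x `^ a).
Proof. by apply: (measurableT_comp (measurable_powR _)); exact: measurable_hrho. Qed.

Lemma measurable_norm_powR (h : 'rV[R]_N -> R) a : measurable_fun [set: 'rV[R]_N] h ->
  measurable_fun [set: 'rV[R]_N] (fun x => `|h x| `^ a).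
Proof.
by move=> mh; apply: (measurableT_comp (measurable_powR _)); exact: measurableT_comp.
Qed.

Lemma interpolation_pointwise (rho y b c p delta t : R) : 0 < rho -> 0 < p ->
  0 < delta -> t = b * (1 - delta) - c ->
  `|rho `^ c * y| `^ p =
  `|y * rho `^ (- (t / delta))| `^ (delta * p) *
  `|rho `^ b * y| `^ ((1 - delta) * p).
Proof.
move=> r0 p0 d0 tE.
rewrite !normrM !(@ger0_norm _ (_ `^ _)) ?powR_ge0//.
move: (`|y|) (normr_ge0 y) => {}y y0.
rewrite !powRM ?powR_ge0// -!powRrM.
have -> : c * p = - (t / delta) * (delta * p) + b * ((1 - delta) * p).
  by rewrite tE; field; rewrite gt_eqF.
have -> : y `^ p = y `^ (delta * p) * y `^ ((1 - delta) * p).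
  rewrite -powRD -mulrDl subrKC mul1r// gt_eqF//.
rewrite powRD; last by rewrite (gt_eqF r0) implybT.
by ring.
Qed.

(** Hoelder's inequality for the p3-th powers, with exponents [P] and [Q], since [p3] itself may be
    below 1. The formula for [q] says exactly that 1/P + 1/Q = 1; [delta < 1] keeps [Q] finite. *)
Lemma hLnorm_interpolation (f : 'rV[R]_N -> R) (b c p2 p3 delta : R) :
  measurable_fun [set: 'rV[R]_N] f ->
  0 < p3 -> 0 < p2 -> 0 < delta -> delta < 1 -> 0 < p2 - (1 - delta) * p3 ->
  let q := delta * p2 * p3 / (p2 - (1 - delta) * p3) in
  (hLnorm p3 (fun x => (hrho x `^ c * f x)%R) <=
   hLnorm q (fun x => (f x / hrho x `^ ((b * (1 - delta) - c) / delta))%R) `^ delta *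
   hLnorm p2 (fun x => (hrho x `^ b * f x)%R) `^ (1 - delta))%E.
Proof.
move=> mf p3_gt0 p2_gt0 d_gt0 d_lt1 a_gt0 /=; set q := _ / (p2 - _).
set t := b * (1 - delta) - c.
have q_gt0 : 0 < q by rewrite divr_gt0// !mulr_gt0.
have d1 : 0 < 1 - delta by rewrite subr_gt0.
pose u x := f x / hrho x `^ (t / delta).
pose v x := hrho x `^ b * f x.
have mu_ : measurable_fun [set: 'rV[R]_N] u.
  apply: measurable_funM => //.
  apply: (@measurableT_comp _ _ _ _ _ _ (fun s : R => s^-1)).
    exact: measurable_inv.
  exact: measurable_hrho_powR.
have mv : measurable_fun [set: 'rV[R]_N] v.
  by apply: measurable_funM => //; exact: measurable_hrho_powR.
pose P := q / (delta * p3); pose Q := p2 / ((1 - delta) * p3).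
have P0 : 0 < P by rewrite divr_gt0// mulr_gt0.
have Q0 : 0 < Q by rewrite divr_gt0// mulr_gt0.
have PQ : P^-1 + Q^-1 = 1.
  rewrite /P /Q /q; field.
  by rewrite !gt_eqF.
have mF := measurable_norm_powR (delta * p3) mu_.
have mH := measurable_norm_powR ((1 - delta) * p3) mv.
have := hoelder hvol mF mH P0 Q0 PQ.
have uP : delta * p3 * P = q by rewrite mulrC divfK// gt_eqF// mulr_gt0.
have vQ : (1 - delta) * p3 * Q = p2 by rewrite mulrC divfK// gt_eqF// mulr_gt0.
rewrite Lnorm1 (Lnorm_powR u) (Lnorm_powR v) uP vQ => hld.
rewrite !hLnormE -/u -/v.
have -> : ((\int[hvol]_x (`|u x| `^ q)%:E) `^ q^-1 `^ delta =
    ((\int[hvol]_x (`|u x| `^ q)%:E) `^ P^-1) `^ p3^-1)%E.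
  rewrite -!poweRrM; congr (_ `^ _)%E; rewrite /P; field.
  by rewrite !gt_eqF.
have -> : ((\int[hvol]_x (`|v x| `^ p2)%:E) `^ p2^-1 `^ (1 - delta) =
    ((\int[hvol]_x (`|v x| `^ p2)%:E) `^ Q^-1) `^ p3^-1)%E.
  rewrite -!poweRrM; congr (_ `^ _)%E; rewrite /Q; field.
  by rewrite !gt_eqF.
rewrite -poweRM ?poweR_ge0//; apply: gt0_ler_poweR.
- by rewrite invr_ge0 ltW.
- by rewrite in_itv/= leey andbT; apply: integral_ge0 => x _; rewrite lee_fin powR_ge0.
- by rewrite in_itv/= leey andbT mule_ge0 ?poweR_ge0.
apply: le_trans hld.
apply: ae_ge0_le_integral => //.
- apply/measurable_EFinP; apply: measurable_norm_powR.
  by apply: measurable_funM => //; exact: measurable_hrho_powR.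
- apply/measurable_EFinP; apply: measurableT_comp => //; exact: measurable_funM.
- apply: filterS ae_hball_neq0 => x [xB x0] _ /=.
  rewrite lee_fin; apply: le_trans (ler_norm _).
  rewrite (interpolation_pointwise _ (hrho_gt0 xB x0) p3_gt0 d_gt0 (erefl t)).
  by rewrite powRN.
Qed.

End interpolation.

Unset Implicit Arguments.

Theorem theorem5p1 (R : realType) (n : nat) (n_ge2 : (2 <= n)%N) :
  exists C2 : R -> R -> R,
  forall b c p2 p3 delta : R,
    0 < p3 -> 1 < p2 ->
    0 < delta -> (p3 - p2) / p3 < delta -> delta <= 1 ->
    let q := delta * p2 * p3 / (p2 - (1 - delta) * p3) in
    let beta := q * (b * (1 - delta) - c) / delta in
    0 <= b * (1 - delta) - c ->
    b * (1 - delta) - c < n%:R * (p3^-1 - (1 - delta) / p2) ->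
    n%:R <= q ->
    [/\ 0 <= beta < n%:R,
        0 < C2 beta q,
        singular_sobolev n beta q (C2 beta q) &
        forall C : R, 0 < C -> singular_sobolev n beta q C ->
        forall f : sobolev R n,
          (hLnorm p3 (fun x => (hrho x `^ c * f x)%R)
           <= (C `^ delta *
               (delta * p2 * p3 / (p2 - (1 - delta) * p3))
                 `^ (delta - delta / n%:R))%:E
              * grad_norm f `^ delta
              * hLnorm p2 (fun x => (hrho x `^ b * f x)%R) `^ (1 - delta))%E].
Proof.
case: n n_ge2 => [//|[//|n] _].
(* [C2] has to be a function of beta and q alone, fixed before the other parameters; outside the
   admissible range it takes the default value 1. *)
have exC (z : R * R) : exists C : R, 0 < C /\
    (n.+2%:R <= z.2 -> 0 <= z.1 -> z.1 < n.+2%:R -> singular_sobolev n.+2 z.1 z.2 C).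
  have [[/andP[z0 zn] zq]|zN] := pselect ((0 <= z.1 < n.+2%:R) /\ n.+2%:R <= z.2).
    by have [C C0 CP] := singular_sobolev_exists zq z0 zn; exists C.
  by exists 1; split => // zq z0 zn; case: zN; rewrite z0 zn.
have [C2 C2P] := choice exC; exists (fun beta q => C2 (beta, q)).
move=> b c p2 p3 delta p3_gt0 p2_gt1 d_gt0 dP d_le1 q beta t_ge0 tP nq.
have p2_gt0 : 0 < p2 by exact: lt_trans p2_gt1.
(* This is the lower bound on [delta] multiplied by [p3]. *)
have a_gt0 : 0 < p2 - (1 - delta) * p3.
  by move: dP; rewrite ltr_pdivrMr//; lra.
have q_gt0 : 0 < q by rewrite divr_gt0// !mulr_gt0.
have beta_ge0 : 0 <= beta by exact: divr_ge0 (mulr_ge0 (ltW q_gt0) t_ge0) (ltW d_gt0).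
have beta_ltn : beta < n.+2%:R.
  (* The same factor times the upper bound in [tP] is exactly the dimension. *)
  have -> : beta = p2 * p3 / (p2 - (1 - delta) * p3) * (b * (1 - delta) - c).
    by rewrite /beta /q; field; rewrite (gt_eqF a_gt0) (gt_eqF d_gt0).
  have h0 : 0 < p2 * p3 / (p2 - (1 - delta) * p3) by rewrite divr_gt0// mulr_gt0.
  rewrite -(ltr_pM2l h0) in tP; apply: lt_le_trans tP _.
  by rewrite le_eqVlt; apply/orP; left; apply/eqP; field; rewrite (gt_eqF a_gt0) (gt_eqF p2_gt0) (gt_eqF p3_gt0).
have [C2_gt0 C2S] := C2P (beta, q).
split => //; first by rewrite beta_ge0 beta_ltn.
  exact: C2S.
move=> C C_gt0 CS f; rewrite -/q.
(* Thus the singular inequality bounds precisely the first factor in Hoelder's inequality. *)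
have betaq : beta / q = (b * (1 - delta) - c) / delta.
  by rewrite /beta mulrAC [q * _]mulrC mulfK// gt_eqF.
have Sf := CS f; rewrite betaq in Sf.
have w0 : 0 <= C * q `^ (1 - n.+2%:R^-1) by rewrite mulr_ge0 ?powR_ge0// ltW.
have constE : (((C * q `^ (1 - n.+2%:R^-1))%:E * grad_norm f) `^ delta =
    (C `^ delta * q `^ (delta - delta / n.+2%:R))%:E * grad_norm f `^ delta)%E.
  rewrite poweRM ?lee_fin ?Lnorm_ge0// poweR_EFin powRM ?powR_ge0 ?(ltW C_gt0)//.
  by rewrite -powRrM mulrBl mul1r [_^-1 * delta]mulrC.
rewrite -constE.
(* For [delta = 1] the second Hoelder exponent degenerates, but then [q = p3] and [beta / q = - c],
   and the claim is the singular inequality itself; the factor with exponent 0 is 1. *)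
move: d_le1; rewrite le_eqVlt => /predU1P[d1|d_lt1]; last first.
  have := hLnorm_interpolation b c (sob_fun_measurable f) p3_gt0 p2_gt0 d_gt0 d_lt1 a_gt0.
  move=> /le_trans; apply; rewrite lee_wpmul2r ?poweR_ge0//.
  apply: gt0_ler_poweR; rewrite ?in_itv/= ?leey ?andbT ?Lnorm_ge0 ?(ltW d_gt0)//.
  by rewrite mule_ge0 ?lee_fin ?Lnorm_ge0.
have qE : q = p3 by rewrite /q d1; field; rewrite gt_eqF.
rewrite d1 subrr poweRe0 mule1 poweRe1; last by rewrite mule_ge0 ?lee_fin ?Lnorm_ge0.
move: Sf; rewrite qE d1 subrr mulr0 sub0r divr1; apply: le_trans.
rewrite le_eqVlt; apply/orP; left; apply/eqP; apply: eq_Lnorm => x /=.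
by rewrite powRN invrK mulrC.
Qed.
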